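(* Let $G$ be an abelian group and let $(\mathcal{C},c)$ be a braided tensor category over a field $k$ with a coherent central outer $G$-action. Then there is a bijective correspondence between braidings over $\mathcal{C}\rtimes G$ and braidings over the central coherent outer $G$-action of $\mathcal{C}$.
   Context: **Conventions.** A tensor category $(\mathcal{C},\otimes,\alpha,I)$ is a $k$-linear abelian category with a $k$-bilinear exact bifunctor $\otimes$, a unit object $I$ with $V\otimes I=V=I\otimes V$, and an associativity constraint satisfying the pentagon axiom, with $\alpha_{V,I,W}=\mathrm{id}$ and $\dim_k\mathrm{End}(I)=1$. Tensor symbols between objects and associativity constraints of $\mathcal{C}$ are omitted below. $\mathcal{Z}(\mathcal{C})$ is the (Drinfeld) center: objects are pairs $(U,\chi)$ with $U\in\mathcal{C}$ and natural isomorphisms $\chi(Z):Z\,U\to U\,Z$ with $\chi(I)=\mathrm{id}$ and $\chi(V\otimes W)=(\chi(V)\otimes\mathrm{id})\circ(\mathrm{id}\otimes\chi(W))$; morphisms are morphisms of $\mathcal{C}$ commuting with the $\chi$'s. **Braiding on a monoidal category** (with associativity $a_{U,V,W}:U\otimes(V\otimes W)\to(U\otimes V)\otimes W$): a natural isomorphism $c_{U,V}:U\otimes V\to V\otimes U$ satisfying $$a_{W,U,V}\circ c_{U\otimes V,W}\circ a_{U,V,W}=(c_{U,W}\otimes\mathrm{id})\circ a_{U,W,V}\circ(\mathrm{id}\otimes c_{V,W}),$$ $$a^{-1}_{V,W,U}\circ c_{U,V\otimes W}\circ a^{-1}_{U,V,W}=(\mathrm{id}\otimes c_{U,W})\circ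 a^{-1}_{V,U,W}\circ(c_{U,V}\otimes\mathrm{id}).$$ **Coherent central outer $G$-action on $\mathcal{C}$.** This is a coherent outer $G$-action all of whose monoidal functors $\sigma_*$ ($\sigma\in G$) are $\mathrm{id}_{\mathcal{C}}$. Explicitly: invertible objects $(U_{\sigma,\tau},\chi_{\sigma,\tau})\in\mathcal{Z}(\mathcal{C})$ for $\sigma,\tau\in G$ and isomorphisms $\omega_{\sigma,\tau,\rho}:U_{\tau,\rho}U_{\sigma,\tau\rho}\to U_{\sigma,\tau}U_{\sigma\tau,\rho}$ in $\mathcal{Z}(\mathcal{C})$, normalized by $(U_{e,\sigma},\chi_{e,\sigma})=(U_{\sigma,e},\chi_{\sigma,e})=(I,\mathrm{id})$ and $\omega_{\sigma,e,\tau}=\mathrm{id}$, such that for all $\sigma,\tau,\rho,\mu\in G$ the following two morphisms $U_{\rho,\mu}U_{\tau,\rho\mu}U_{\sigma,\tau\rho\mu}\to U_{\sigma,\tau}U_{\sigma\tau,\rho}U_{\sigma\tau\rho,\mu}$ coincide: $$(\omega_{\sigma,\tau,\rho}\otimes\mathrm{id})\circ(\mathrm{id}\otimes\omega_{\sigma,\tau\rho,\mu})\circ(\omega_{\tau,\rho,\mu}\otimes\mathrm{id}),\qquad(\mathrm{id}\otimes\omega_{\sigma\tau,\rho,\mu})\circ(\chi_{\sigma,\tau}(U_{\rho,\mu})\otimes\mathrm{id})\circ(\mathrm{id}\otimes\omega_{\sigma,\tau,\rho\mu}).$$ **The tensor category $\mathcal{C}\rtimes G$.** As an abelian category $\mathcal{C}\rtimes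 G=\bigoplus_{\sigma\in G}\mathcal{C}_\sigma$ with $\mathcal{C}_\sigma=\mathcal{C}$; $[V,\sigma]$ denotes $V\in\mathcal{C}_\sigma$. For a central action the tensor product is $[V,\sigma]\cdot[W,\tau]=[V\,W\,U_{\sigma,\tau},\sigma\tau]$, $[f,\sigma]\cdot[g,\tau]=[f\otimes g\otimes\mathrm{id}_{U_{\sigma,\tau}},\sigma\tau]$, with unit $[I,e]$, and associativity $[V,\sigma]\cdot([W,\tau]\cdot[Z,\rho])\to([V,\sigma]\cdot[W,\tau])\cdot[Z,\rho]$ given by $$(\mathrm{id}_{V W}\otimes\chi_{\sigma,\tau}(Z)\otimes\mathrm{id}_{U_{\sigma\tau,\rho}})\circ(\mathrm{id}_{V W Z}\otimes\omega_{\sigma,\tau,\rho}):V W Z U_{\tau,\rho}U_{\sigma,\tau\rho}\to V W U_{\sigma,\tau}Z U_{\sigma\tau,\rho}.$$ **Braiding for the central coherent outer $G$-action over $(\mathcal{C},c)$.** A triple $(\theta^\sigma,\overline\theta^\sigma,t_{\sigma,\tau})_{\sigma,\tau\in G}$ where $\theta^\sigma,\overline\theta^\sigma:\mathrm{id}_{\mathcal{C}}\to\mathrm{id}_{\mathcal{C}}$ are monoidal natural isomorphisms and $t_{\sigma,\tau}:(U_{\sigma,\tau},\chi_{\sigma,\tau})\to(U_{\tau,\sigma},\chi_{\tau,\sigma})$ are isomorphisms in $\mathcal{Z}(\mathcal{C})$, such that $\theta^e=\overline\theta^e=\mathrm{id}$, $\theta^\sigma_I=\mathrm{id}_I$, $t_{\sigma,e}=t_{e,\sigma}=\mathrm{id}_I$,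 and for all $\sigma,\tau,\rho\in G$, $Z\in\mathcal{C}$: (B1) $c_{U_{\sigma,\tau},Z}\circ\chi_{\sigma,\tau}(Z)=\big((\overline\theta^{\sigma\tau}_Z)^{-1}\overline\theta^\sigma_Z\overline\theta^\tau_Z\big)\otimes\mathrm{id}_{U_{\sigma,\tau}}$ on $Z\,U_{\sigma,\tau}$; (B2) $\chi_{\sigma,\tau}(Z)^{-1}\circ c_{Z,U_{\sigma,\tau}}=\big((\theta^{\sigma\tau}_Z)^{-1}\theta^\sigma_Z\theta^\tau_Z\big)\otimes\mathrm{id}_{U_{\sigma,\tau}}$ on $Z\,U_{\sigma,\tau}$; (B3) $\omega_{\rho,\sigma,\tau}\circ(\theta^\rho_{U_{\sigma,\tau}}\otimes t_{\sigma\tau,\rho})\circ\omega_{\sigma,\tau,\rho}=(t_{\sigma,\rho}\otimes\mathrm{id}_{U_{\sigma\rho,\tau}})\circ\omega_{\sigma,\rho,\tau}\circ(t_{\tau,\rho}\otimes\mathrm{id}_{U_{\sigma,\tau\rho}})$ as maps $U_{\tau,\rho}U_{\sigma,\tau\rho}\to U_{\rho,\sigma}U_{\sigma\rho,\tau}$; (B4) $\omega^{-1}_{\tau,\rho,\sigma}\circ(\overline\theta^\sigma_{U_{\tau,\rho}}\otimes t_{\sigma,\tau\rho})\circ\omega^{-1}_{\sigma,\tau,\rho}=(t_{\sigma,\rho}\otimes\mathrm{id}_{U_{\tau,\sigma\rho}})\circ\omega^{-1}_{\tau,\sigma,\rho}\circ(t_{\sigma,\tau}\otimes\mathrm{id}_{U_{\sigma\tau,\rho}})$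 as maps $U_{\sigma,\tau}U_{\sigma\tau,\rho}\to U_{\rho,\sigma}U_{\tau,\rho\sigma}$.
   Formalization: ''Braidings over C⋊G'' is taken to mean braidings whose restriction to C = C_e is the given c; without this the claim fails, e.g. for trivial G and C = Vec_{Z/2} (char ≠ 2), which has two braidings but only one triple. *)

(* Defs.v *)
From HB Require Import structures.
From mathcomp Require Import all_boot all_algebra.
From mathcomp Require Import boolp.

Set Implicit Arguments.
Unset Strict Implicit.
Unset Printing Implicit Defensive.

Import GRing.Theory.

Local Obligation Tactic := idtac.

Declare Scope cat_scope.
Delimit Scope cat_scope with cat.

Local Open Scope ring_scope.
Local Open Scope cat_scope.

(* The operations of a k-linear monoidal category, without axioms: this is all
   that is needed to say what a braiding is.  [assoc X Y Z] goes from X(YZ) to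
   (XY)Z and [assocV X Y Z] is its inverse. *)
Record monData (k : fieldType) := MonData {
  ob : Type;
  hom : ob -> ob -> lmodType k;
  idm : forall X, hom X X;
  comp : forall X Y Z, hom Y Z -> hom X Y -> hom X Z;
  unit_ob : ob;
  ten : ob -> ob -> ob;
  tenm : forall X X' Y Y', hom X X' -> hom Y Y' -> hom (ten X Y) (ten X' Y');
  assoc : forall X Y Z, hom (ten X (ten Y Z)) (ten (ten X Y) Z);
  assocV : forall X Y Z, hom (ten (ten X Y) Z) (ten X (ten Y Z))
}.

Arguments hom {k m} X Y.
Arguments idm {k m} X.
Arguments comp {k m X Y Z} g f.
Arguments unit_ob {k} m.
Arguments ten {k m} X Y.
Arguments tenm {k m X X' Y Y'} f g.
Arguments assoc {k m} X Y Z.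
Arguments assocV {k m} X Y Z.

Notation "g ∘ f" := (comp g f) (at level 40, left associativity) : cat_scope.
Notation "X ⊗ Y" := (ten X Y) (at level 39, left associativity) : cat_scope.
Notation "f ⊠ g" := (tenm f g) (at level 39, left associativity) : cat_scope.
Notation "X ◁ f" := (tenm (idm X) f) (at level 39, left associativity) : cat_scope.
Notation "f ▷ Y" := (tenm f (idm Y)) (at level 39, left associativity) : cat_scope.

Section Generic.
Variables (k : fieldType) (M : monData k).
Implicit Types X Y Z : ob M.

Record iso X Y := Iso {
  fwd : hom X Y;
  bwd : hom Y X;
  fwdK : bwd ∘ fwd = idm X;
  bwdK : fwd ∘ bwd = idm Y
}.

(* The identity morphism between two (propositionally) equal objects. *)
Definition eqhom X Y (E : X = Y) : hom X Y :=
  match E in _ = Y' return hom X Y' with erefl => idm X end.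

Definition is_identity X Y (f : hom X Y) : Prop := exists E : X = Y, f = eqhom E.

(* [f] and [g] are the same morphism, up to equality of (co)domains. *)
Definition same_mor X Y X' Y' (f : hom X Y) (g : hom X' Y') : Prop :=
  exists (EX : X = X') (EY : Y = Y'), g ∘ eqhom EX = eqhom EY ∘ f.

(* F x -> F y is the identity if x = y, and 0 otherwise. *)
Definition delta_hom (T : eqType) (F : T -> ob M) (x y : T) : hom (F x) (F y) :=
  match x =P y with
  | ReflectT E => eqhom (congr1 F E)
  | ReflectF _ => 0
  end.

Record braiding := Braiding {
  br : forall X Y, iso (X ⊗ Y) (Y ⊗ X);
  br_nat : forall X X' Y Y' (f : hom X X') (g : hom Y Y'),
    fwd (br X' Y') ∘ (f ⊠ g) = (g ⊠ f) ∘ fwd (br X Y);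
  br_hexagon1 : forall X Y Z,
    assoc Z X Y ∘ fwd (br (X ⊗ Y) Z) ∘ assoc X Y Z =
    (fwd (br X Z) ▷ Y) ∘ assoc X Z Y ∘ (X ◁ fwd (br Y Z));
  br_hexagon2 : forall X Y Z,
    assocV Y Z X ∘ fwd (br X (Y ⊗ Z)) ∘ assocV X Y Z =
    (Y ◁ fwd (br X Z)) ∘ assocV Y X Z ∘ (fwd (br X Y) ▷ Z)
}.

Definition zero_object Z : Prop :=
  forall X, (forall f : hom X Z, f = 0) /\ (forall f : hom Z X, f = 0).

Definition is_biproduct X Y P : Prop :=
  exists (i1 : hom X P) (i2 : hom Y P) (p1 : hom P X) (p2 : hom P Y),
    [/\ p1 ∘ i1 = idm X, p2 ∘ i2 = idm Y, p1 ∘ i2 = 0, p2 ∘ i1 = 0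
      & i1 ∘ p1 + i2 ∘ p2 = idm P].

Definition is_kernel X Y K (f : hom X Y) (i : hom K X) : Prop :=
  f ∘ i = 0 /\
  forall T (h : hom T X), f ∘ h = 0 -> exists! u : hom T K, i ∘ u = h.

Definition is_cokernel X Y Q (f : hom X Y) (p : hom Y Q) : Prop :=
  p ∘ f = 0 /\
  forall T (h : hom Y T), h ∘ f = 0 -> exists! u : hom Q T, u ∘ p = h.

Definition mono X Y (f : hom X Y) : Prop :=
  forall T (u v : hom T X), f ∘ u = f ∘ v -> u = v.

Definition epi X Y (f : hom X Y) : Prop :=
  forall T (u v : hom Y T), u ∘ f = v ∘ f -> u = v.

Definition short_exact X Y Z (f : hom X Y) (g : hom Y Z) : Prop :=
  is_kernel g f /\ is_cokernel f g.

Record is_linear_category : Prop := {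
  comp1m : forall X Y (f : hom X Y), idm Y ∘ f = f;
  compm1 : forall X Y (f : hom X Y), f ∘ idm X = f;
  compA : forall X Y Z T (h : hom Z T) (g : hom Y Z) (f : hom X Y),
    h ∘ (g ∘ f) = h ∘ g ∘ f;
  comp_linearl : forall X Y Z (f : hom X Y) a (g g' : hom Y Z),
    (a *: g + g') ∘ f = a *: (g ∘ f) + g' ∘ f;
  comp_linearr : forall X Y Z (g : hom Y Z) a (f f' : hom X Y),
    g ∘ (a *: f + f') = a *: (g ∘ f) + g ∘ f'
}.

Record is_abelian : Prop := {
  has_zero : exists Z, zero_object Z;
  has_biproducts : forall X Y, exists P, is_biproduct X Y P;
  has_kernels : forall X Y (f : hom X Y), exists K (i : hom K X), is_kernel f i;
  has_cokernels : forall X Y (f : hom X Y),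
    exists Q (p : hom Y Q), is_cokernel f p;
  mono_normal : forall X Y (f : hom X Y), mono f ->
    exists Z (g : hom Y Z), is_kernel g f;
  epi_normal : forall X Y (f : hom X Y), epi f ->
    exists Z (g : hom Z X), is_cokernel g f
}.

Record is_tensor_bifunctor : Prop := {
  tenm1 : forall X Y, idm X ⊠ idm Y = idm (X ⊗ Y);
  tenm_comp : forall X X' X'' Y Y' Y''
      (f' : hom X' X'') (f : hom X X') (g' : hom Y' Y'') (g : hom Y Y'),
    (f' ∘ f) ⊠ (g' ∘ g) = (f' ⊠ g') ∘ (f ⊠ g);
  tenm_linearl : forall X X' Y Y' (g : hom Y Y') a (f f' : hom X X'),
    (a *: f + f') ⊠ g = a *: (f ⊠ g) + f' ⊠ g;
  tenm_linearr : forall X X' Y Y' (f : hom X X') a (g g' : hom Y Y'),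
    f ⊠ (a *: g + g') = a *: (f ⊠ g) + f ⊠ g';
  ten_exactl : forall W X Y Z (f : hom X Y) (g : hom Y Z),
    short_exact f g -> short_exact (W ◁ f) (W ◁ g);
  ten_exactr : forall W X Y Z (f : hom X Y) (g : hom Y Z),
    short_exact f g -> short_exact (f ▷ W) (g ▷ W)
}.

Record is_associativity : Prop := {
  assocK : forall X Y Z, assocV X Y Z ∘ assoc X Y Z = idm _;
  assocVK : forall X Y Z, assoc X Y Z ∘ assocV X Y Z = idm _;
  assoc_nat : forall X X' Y Y' Z Z'
      (f : hom X X') (g : hom Y Y') (h : hom Z Z'),
    assoc X' Y' Z' ∘ (f ⊠ (g ⊠ h)) = ((f ⊠ g) ⊠ h) ∘ assoc X Y Z;
  pentagon : forall X Y Z T,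
    assoc (X ⊗ Y) Z T ∘ assoc X Y (Z ⊗ T) =
    (assoc X Y Z ▷ T) ∘ assoc X (Y ⊗ Z) T ∘ (X ◁ assoc Y Z T)
}.

(* V ⊗ I = V = I ⊗ V holds strictly, on objects and on morphisms. *)
Record is_strict_unit : Prop := {
  ten1r : forall X, X ⊗ unit_ob M = X;
  ten1l : forall X, unit_ob M ⊗ X = X;
  tenm1r : forall X Y (f : hom X Y), same_mor (f ▷ unit_ob M) f;
  tenm1l : forall X Y (f : hom X Y), same_mor (unit_ob M ◁ f) f;
  assoc_unit : forall X Y, is_identity (assoc X (unit_ob M) Y);
  dim_End_unit : exists e : hom (unit_ob M) (unit_ob M),
    e != 0 /\ forall f, exists a : k, f = a *: e
}.

End Generic.

Record tensorCat (k : fieldType) := TensorCat {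
  tc_data :> monData k;
  tc_linear : is_linear_category tc_data;
  tc_abelian : is_abelian tc_data;
  tc_bifunctor : is_tensor_bifunctor tc_data;
  tc_assoc : is_associativity tc_data;
  tc_unit : is_strict_unit tc_data
}.

Section Center.
Variables (k : fieldType) (C : tensorCat k).
Implicit Types V W Z : ob C.

Record zobj := ZObj {
  zob :> ob C;
  zbr : forall Z, iso (Z ⊗ zob) (zob ⊗ Z);
  zbr_nat : forall Z Z' (f : hom Z Z'),
    fwd (zbr Z') ∘ (f ▷ zob) = (zob ◁ f) ∘ fwd (zbr Z);
  zbr_unit : is_identity (fwd (zbr (unit_ob C)));
  zbr_ten : forall V W,
    fwd (zbr (V ⊗ W)) =
    assocV zob V W ∘ (fwd (zbr V) ▷ W) ∘ assoc V zob W
      ∘ (V ◁ fwd (zbr W)) ∘ assocV V W zob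
}.

(* Families Z U -> U Z; they are used to speak of morphisms of the center
   between tensor products. *)
Definition half_braiding (U : ob C) := forall Z, hom (Z ⊗ U) (U ⊗ Z).

Definition hb (X : zobj) : half_braiding X := fun Z => fwd (zbr X Z).

Definition hb_unit : half_braiding (unit_ob C) :=
  fun Z => eqhom (etrans (ten1r (tc_unit C) Z) (esym (ten1l (tc_unit C) Z))).

Definition hb_ten U U' (x : half_braiding U) (x' : half_braiding U') :
    half_braiding (U ⊗ U') :=
  fun Z => assoc U U' Z ∘ (U ◁ x' Z) ∘ assocV U Z U' ∘ (x Z ▷ U') ∘ assoc Z U U'.

Definition central U U' (x : half_braiding U) (x' : half_braiding U')
    (f : hom U U') : Prop :=
  forall Z, x' Z ∘ (Z ◁ f) = (f ▷ Z) ∘ x Z.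

Definition z_invertible (X : zobj) : Prop :=
  exists (Y : zobj) (f : iso (X ⊗ Y) (unit_ob C)) (g : iso (Y ⊗ X) (unit_ob C)),
    central (hb_ten (hb X) (hb Y)) hb_unit (fwd f) /\
    central (hb_ten (hb Y) (hb X)) hb_unit (fwd g).

(* (U, chi) = (I, id) *)
Definition is_zunit (X : zobj) : Prop :=
  zob X = unit_ob C /\ forall Z, is_identity (hb X Z).

(* Monoidal natural automorphisms of the identity functor. *)
Record monNatAut := MonNatAut {
  na :> forall Z, iso Z Z;
  na_nat : forall Z Z' (f : hom Z Z'), fwd (na Z') ∘ f = f ∘ fwd (na Z);
  na_ten : forall V W, fwd (na (V ⊗ W)) = fwd (na V) ⊠ fwd (na W);
  na_unit : fwd (na (unit_ob C)) = idm (unit_ob C)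
}.

End Center.

Section Action.
Variables (k : fieldType) (G : groupType) (C : tensorCat k).
Local Open Scope group_scope.

(* The identity U_{s,t} -> U_{s',t'} for s = s' and t = t'. *)
Definition ucast (U : G -> G -> zobj C) s s' t t' (Es : s = s') (Et : t = t') :
    hom (U s t) (U s' t') :=
  eqhom (f_equal2 (fun a b => zob (U a b)) Es Et).

Record centralOuterAction := CentralOuterAction {
  cU : G -> G -> zobj C;
  cU_invertible : forall s t, z_invertible (cU s t);
  om : forall s t r,
    iso (cU t r ⊗ cU s (t * r)) (cU s t ⊗ cU (s * t) r);
  om_central : forall s t r,
    central (hb_ten (hb (cU t r)) (hb (cU s (t * r))))
            (hb_ten (hb (cU s t)) (hb (cU (s * t) r))) (fwd (om s t r));
  cU1l : forall s, is_zunit (cU 1 s);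
  cU1r : forall s, is_zunit (cU s 1);
  om1 : forall s t, is_identity (fwd (om s 1 t));
  om_coherent : forall s t r m,
    (fwd (om s t r) ⊠ ucast cU (mulgA s t r) (erefl m))
      ∘ assoc (cU t r) (cU s (t * r)) (cU (s * (t * r)) m)
      ∘ (cU t r ◁ fwd (om s (t * r) m))
      ∘ assocV (cU t r) (cU (t * r) m) (cU s (t * r * m))
      ∘ (fwd (om t r m) ⊠ ucast cU (erefl s) (mulgA t r m))
    = assoc (cU s t) (cU (s * t) r) (cU (s * t * r) m)
      ∘ (cU s t ◁ fwd (om (s * t) r m))
      ∘ assocV (cU s t) (cU r m) (cU (s * t) (r * m))
      ∘ (hb (cU s t) (cU r m) ▷ cU (s * t) (r * m))
      ∘ assoc (cU r m) (cU s t) (cU (s * t) (r * m))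
      ∘ (cU r m ◁ fwd (om s t (r * m)))
      ∘ assocV (cU r m) (cU t (r * m)) (cU s (t * (r * m)))
}.

End Action.

Section ActionBraiding.
Variables (k : fieldType) (G : groupType) (C : tensorCat k).
Hypothesis mulGC : forall s t : G, (s * t = t * s)%g.
Variables (c : braiding C) (A : centralOuterAction G C).
Local Open Scope group_scope.
Local Notation U := (cU A).
Local Notation ω := (om A).

(* The maps [ucast _ _ _] below are the identities between objects U_{s,t}
   whose indices agree by commutativity of G. *)
Record actionBraiding := ActionBraiding {
  th : G -> monNatAut C;
  thb : G -> monNatAut C;
  tw : forall s t, iso (U s t) (U t s);
  tw_central : forall s t, central (hb (U s t)) (hb (U t s)) (fwd (tw s t));
  th1 : forall Z, fwd (th 1 Z) = idm Z;
  thb1 : forall Z, fwd (thb 1 Z) = idm Z;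
  th_unit : forall s, fwd (th s (unit_ob C)) = idm (unit_ob C);
  tw1r : forall s, is_identity (fwd (tw s 1));
  tw1l : forall s, is_identity (fwd (tw 1 s));
  actionB1 : forall s t Z,
    fwd (br c (U s t) Z) ∘ fwd (zbr (U s t) Z) =
    (bwd (thb (s * t) Z) ∘ fwd (thb s Z) ∘ fwd (thb t Z)) ▷ U s t;
  actionB2 : forall s t Z,
    bwd (zbr (U s t) Z) ∘ fwd (br c Z (U s t)) =
    (bwd (th (s * t) Z) ∘ fwd (th s Z) ∘ fwd (th t Z)) ▷ U s t;
  actionB3 : forall s t r,
    fwd (ω r s t) ∘ (fwd (th r (U s t)) ⊠ fwd (tw (s * t) r)) ∘ fwd (ω s t r) =
    (fwd (tw s r) ⊠ ucast U (mulGC s r) (erefl t)) ∘ fwd (ω s r t)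
      ∘ (fwd (tw t r) ⊠ ucast U (erefl s) (mulGC t r));
  actionB4 : forall s t r,
    bwd (ω t r s) ∘ (fwd (thb s (U t r)) ⊠ fwd (tw s (t * r))) ∘ bwd (ω s t r) =
    (fwd (tw s r) ⊠ ucast U (erefl t) (mulGC s r)) ∘ bwd (ω t s r)
      ∘ (fwd (tw s t) ⊠ ucast U (mulGC s t) (erefl r))
}.

End ActionBraiding.

Section ZeroLemmas.
Variables (k : fieldType) (C : tensorCat k).
Implicit Types X Y Z : ob C.

Lemma linear_fun0 (V W : lmodType k) (f : V -> W) :
  (forall a u v, f (a *: u + v) = a *: f u + f v) -> f 0 = 0.
Proof. by move=> lf; have := lf (-1) 0 0; rewrite scaler0 add0r scaleN1r addNr. Qed.

Lemma comp0m X Y Z (f : hom X Y) : (0 : hom Y Z) ∘ f = 0.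
Proof. exact: (linear_fun0 (comp_linearl (tc_linear C) f)). Qed.

Lemma compm0 X Y Z (g : hom Y Z) : g ∘ (0 : hom X Y) = 0.
Proof. exact: (linear_fun0 (comp_linearr (tc_linear C) g)). Qed.

Lemma tenm0 X X' Y Y' (f : hom X X') : f ⊠ (0 : hom Y Y') = 0.
Proof. exact: (linear_fun0 (tenm_linearr (tc_bifunctor C) f)). Qed.

End ZeroLemmas.

(* The direct sum of copies C_s = C (s in G), as finite formal direct sums
   of homogeneous objects [V_i, s_i], where i ranges over a finite index type.
   A morphism is a matrix of morphisms V_i -> W_j of C whose entries vanish
   unless s_i = t_j, since Hom([V, s], [W, t]) is Hom(V, W) if s = t and 0
   otherwise.  As C has finite direct sums, this is equivalent to the category of
   finitely supported families (V_s)_{s in G} with componentwise morphisms;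
   it has the advantage that the tensor product of sums of homogeneous objects
   involves no choice of direct sums in C. *)
Section DirectSum.
Variables (k : fieldType) (G : groupType) (C : tensorCat k).

Record sumOb := SumOb {
  idx : finType;
  cmp : idx -> ob C;
  dg : idx -> G
}.

Record sumHom (X Y : sumOb) := SumHom {
  ent :> forall (i : idx X) (j : idx Y), hom (cmp i) (cmp j);
  entP : forall i j, dg i <> dg j -> ent i j = 0
}.

Lemma sumHom_eq (X Y : sumOb) (M N : sumHom X Y) :
  (forall i j, M i j = N i j) -> M = N.
Proof.
case: M N => [M MP] [N NP] /= eqMN.
have E : M = N.
  by apply: functional_extensionality_dep => i;
     apply: functional_extensionality_dep => j; exact: eqMN.
by case: N / E NP {eqMN} => NP; rewrite (Prop_irrelevance MP NP).
Qed.

Section SumHomLmod.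
Variables X Y : sumOb.

HB.instance Definition _ := gen_eqMixin (sumHom X Y).
HB.instance Definition _ := gen_choiceMixin (sumHom X Y).

Program Definition sumHom0 : sumHom X Y := @SumHom X Y (fun _ _ => 0) _.
Next Obligation. by []. Qed.
Program Definition sumHomN (M : sumHom X Y) : sumHom X Y :=
  @SumHom X Y (fun i j => - M i j) _.
Next Obligation. by move=> M i j /entP->; rewrite oppr0. Qed.
Program Definition sumHomD (M N : sumHom X Y) : sumHom X Y :=
  @SumHom X Y (fun i j => M i j + N i j) _.
Next Obligation. by move=> M N i j nij /=; rewrite (entP M nij) (entP N nij) addr0. Qed.
Program Definition sumHomZ (a : k) (M : sumHom X Y) : sumHom X Y :=
  @SumHom X Y (fun i j => a *: M i j) _.
Next Obligation. by move=> a M i j /entP->; rewrite scaler0. Qed.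

Fact sumHom_addA : associative sumHomD.
Proof. by move=> M N P; apply: sumHom_eq => i j /=; rewrite addrA. Qed.
Fact sumHom_addC : commutative sumHomD.
Proof. by move=> M N; apply: sumHom_eq => i j /=; rewrite addrC. Qed.
Fact sumHom_add0 : left_id sumHom0 sumHomD.
Proof. by move=> M; apply: sumHom_eq => i j /=; rewrite add0r. Qed.
Fact sumHom_addN : left_inverse sumHom0 sumHomN sumHomD.
Proof. by move=> M; apply: sumHom_eq => i j /=; rewrite addNr. Qed.

HB.instance Definition _ := GRing.isZmodule.Build (sumHom X Y)
  sumHom_addA sumHom_addC sumHom_add0 sumHom_addN.

Fact sumHom_scaleA a b (M : sumHom X Y) :
  sumHomZ a (sumHomZ b M) = sumHomZ (a * b) M.
Proof. by apply: sumHom_eq => i j /=; rewrite scalerA. Qed.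
Fact sumHom_scale1 : left_id 1 sumHomZ.
Proof. by move=> M; apply: sumHom_eq => i j /=; rewrite scale1r. Qed.
Fact sumHom_scaleDr : right_distributive sumHomZ +%R.
Proof. by move=> a M N; apply: sumHom_eq => i j /=; rewrite scalerDr. Qed.
Fact sumHom_scaleDl (M : sumHom X Y) : {morph sumHomZ^~ M : a b / a + b}.
Proof. by move=> a b; apply: sumHom_eq => i j /=; rewrite scalerDl. Qed.

HB.instance Definition _ := GRing.Zmodule_isLmodule.Build k (sumHom X Y)
  sumHom_scaleA sumHom_scale1 sumHom_scaleDr sumHom_scaleDl.

End SumHomLmod.

Program Definition sum_idm (X : sumOb) : sumHom X X :=
  @SumHom X X (fun i j => delta_hom (@cmp X) i j) _.
Next Obligation.
by move=> X i j /=; rewrite /delta_hom; case: eqP => // ij; case; rewrite ij.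
Qed.

Program Definition sum_comp (X Y Z : sumOb) (N : sumHom Y Z) (M : sumHom X Y) :
    sumHom X Z :=
  @SumHom X Z (fun i l => \sum_j N j l ∘ M i j) _.
Next Obligation.
move=> X Y Z N M i l nil /=; rewrite big1 // => j _.
case: (dg i =P dg j) => [ij|/entP->]; last by rewrite compm0.
by rewrite entP ?comp0m // -ij.
Qed.

(* The matrix with entry f i at (i, phi i), and 0 elsewhere. *)
Program Definition reindex_mor (X Y : sumOb) (phi : idx X -> idx Y)
    (f : forall i, hom (cmp i) (cmp (phi i)))
    (dgf : forall i, dg (phi i) = dg i) : sumHom X Y :=
  @SumHom X Y (fun i j => delta_hom (@cmp Y) (phi i) j ∘ f i) _.
Next Obligation.
move=> X Y phi f dgf i j nij /=; rewrite /delta_hom; case: eqP => [ij|_].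
  by case: nij; rewrite -ij dgf.
by rewrite comp0m.
Qed.

(* The homogeneous object [V, s]. *)
Definition hmg (V : ob C) (s : G) : sumOb :=
  @SumOb unit (fun=> V) (fun=> s).

End DirectSum.

Section CrossedProduct.
Variables (k : fieldType) (G : groupType) (C : tensorCat k).
Variable A : centralOuterAction G C.
Local Open Scope group_scope.
Local Notation U := (cU A).
Local Notation ω := (om A).
Local Notation sumOb := (sumOb G C).

(* [V, s].[W, t] = [V W U_{s,t}, s t], extended to direct sums. *)
Definition cr_ten (X Y : sumOb) : sumOb :=
  @SumOb k G C (idx X * idx Y)%type
    (fun p => cmp p.1 ⊗ cmp p.2 ⊗ U (dg p.1) (dg p.2))
    (fun p => dg p.1 * dg p.2).

(* [f, s].[g, t] = [f g id_{U_{s,t}}, s t], extended to direct sums. *)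
Program Definition cr_tenm (X X' Y Y' : sumOb) (M : sumHom X X') (N : sumHom Y Y') :
    sumHom (cr_ten X Y) (cr_ten X' Y') :=
  @SumHom k G C (cr_ten X Y) (cr_ten X' Y')
    (fun p q => M p.1 q.1 ⊠ N p.2 q.2
       ⊠ delta_hom (fun d : G * G => zob (U d.1 d.2))
           (dg p.1, dg p.2) (dg q.1, dg q.2)) _.
Next Obligation.
move=> X X' Y Y' M N p q /= npq; rewrite /delta_hom.
case: eqP => [E|_]; last by rewrite tenm0.
by case: npq; have /= -> := congr1 fst E; have /= -> := congr1 snd E.
Qed.

Section HomogeneousAssociativity.
Variables (V W Z : ob C) (s t r : G).

Definition hmg_assoc :
  hom (V ⊗ (W ⊗ Z ⊗ U t r) ⊗ U s (t * r)) (V ⊗ W ⊗ U s t ⊗ Z ⊗ U (s * t) r) :=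
  (assoc (V ⊗ W) (U s t) Z ▷ U (s * t) r)
  ∘ ((V ⊗ W ◁ fwd (zbr (U s t) Z)) ▷ U (s * t) r)
  ∘ (assocV (V ⊗ W) Z (U s t) ▷ U (s * t) r)
  ∘ assoc (V ⊗ W ⊗ Z) (U s t) (U (s * t) r)
  ∘ (V ⊗ W ⊗ Z ◁ fwd (ω s t r))
  ∘ assocV (V ⊗ W ⊗ Z) (U t r) (U s (t * r))
  ∘ ((assoc V W Z ▷ U t r) ▷ U s (t * r))
  ∘ (assoc V (W ⊗ Z) (U t r) ▷ U s (t * r)).

Definition hmg_assocV :
  hom (V ⊗ W ⊗ U s t ⊗ Z ⊗ U (s * t) r) (V ⊗ (W ⊗ Z ⊗ U t r) ⊗ U s (t * r)) :=
  (assocV V (W ⊗ Z) (U t r) ▷ U s (t * r))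
  ∘ ((assocV V W Z ▷ U t r) ▷ U s (t * r))
  ∘ assoc (V ⊗ W ⊗ Z) (U t r) (U s (t * r))
  ∘ (V ⊗ W ⊗ Z ◁ bwd (ω s t r))
  ∘ assocV (V ⊗ W ⊗ Z) (U s t) (U (s * t) r)
  ∘ (assoc (V ⊗ W) Z (U s t) ▷ U (s * t) r)
  ∘ ((V ⊗ W ◁ bwd (zbr (U s t) Z)) ▷ U (s * t) r)
  ∘ (assocV (V ⊗ W) (U s t) Z ▷ U (s * t) r).

End HomogeneousAssociativity.

Definition cr_assoc (X Y Z : sumOb) :
    sumHom (cr_ten X (cr_ten Y Z)) (cr_ten (cr_ten X Y) Z) :=
  @reindex_mor k G C (cr_ten X (cr_ten Y Z)) (cr_ten (cr_ten X Y) Z)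
    (fun p => ((p.1, p.2.1), p.2.2))
    (fun p => hmg_assoc (cmp p.1) (cmp p.2.1) (cmp p.2.2)
                        (dg p.1) (dg p.2.1) (dg p.2.2))
    (fun p => esym (mulgA (dg p.1) (dg p.2.1) (dg p.2.2))).

Definition cr_assocV (X Y Z : sumOb) :
    sumHom (cr_ten (cr_ten X Y) Z) (cr_ten X (cr_ten Y Z)) :=
  @reindex_mor k G C (cr_ten (cr_ten X Y) Z) (cr_ten X (cr_ten Y Z))
    (fun p => (p.1.1, (p.1.2, p.2)))
    (fun p => hmg_assocV (cmp p.1.1) (cmp p.1.2) (cmp p.2)
                         (dg p.1.1) (dg p.1.2) (dg p.2))
    (fun p => mulgA (dg p.1.1) (dg p.1.2) (dg p.2)).

Definition crossed : monData k :=
  @MonData k sumOb (fun X Y => sumHom X Y : lmodType k)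
    (@sum_idm k G C) (@sum_comp k G C) (hmg (unit_ob C) 1)
    cr_ten cr_tenm cr_assoc cr_assocV.

(* The braiding b restricts to c on C = C_e, i.e. b_{[V, e], [W, e]} is
   [c_{V,W}, e].  Here [V, e].[W, e] = [V W U_{e,e}, e] with U_{e,e} = I.  The
   braiding c of C is part of the data, so only such b can be considered:
   for trivial G, a braiding of the action is unique but C may well have several
   braidings. *)
Definition extends_braiding (c : braiding C) (b : braiding crossed) : Prop :=
  forall V W : ob C,
    ent (fwd (br b (hmg V 1 : ob crossed) (hmg W 1 : ob crossed)))
      (tt, tt) (tt, tt)
    = fwd (br c V W) ▷ U 1 1.

Definition crossedBraiding (c : braiding C) : Type :=
  {b : braiding crossed | extends_braiding c b}.

End CrossedProduct.

(* Main.v *)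
(* A braiding b of the crossed product is determined by its components at
   homogeneous objects.  Since [V, s] = [V, 1].[I, s], the hexagons force
     b_{[V,s],[W,t]} = (c_{V,W} (th^t_V ⊗ thb^s_W)) ⊗ t_{s,t},
   with th^t_V = b_{[V,1],[I,t]}, thb^s_W = b_{[I,s],[W,1]} and
   t_{s,t} = b_{[I,s],[I,t]}.  For b of this form, the first hexagon amounts to
   (B1) and (B3), together with the monoidality of th^t and the centrality of
   t_{s,t}, and the second one to (B2) and (B4), together with the monoidality
   of thb^s; the centrality of t_{s,t} also follows from (B1), by naturality of c
   and commutativity of G.  All these equations are compared after a
   strictification of C, where bracketings, units and the objects
   U_{1,s} = U_{s,1} = I disappear. *)

From mathcomp Require Import all_boot all_algebra.
From mathcomp Require Import boolp.
Require Import Defs.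

Set Implicit Arguments.
Unset Strict Implicit.
Unset Printing Implicit Defensive.

Import GRing.Theory.
Local Open Scope ring_scope.
Local Open Scope cat_scope.

(** * Identities between equal objects *)

Section EqualityMorphisms.
Variables (k : fieldType) (C : tensorCat k).
Implicit Types X Y Z : ob C.

(** The obstacle is that V ⊗ I = V and the laws of G hold only as propositional equalities, so that
    morphisms which ought to be equal can have different types. [is_identity] and [same_mor] compare
    across such equalities; by proof irrelevance it does not matter which equality proof is used.
    Equalities of degrees are handled by giving products in G variable names instead of casting.
    Strictification conjugates f ▷ T, for every object T, to a map between right-nested words.
    Taking T = I recovers f, so no information is lost. The normalizations cover only the middle
    unit cases $\alpha_{X,I,Y} = id$ and $\omega_{s,1,t} = id$. The outer cases, as well as $c_{X,I}
    = id$ and the triviality of the twists at I, all come from one argument: a coherence axiom makes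
    an invertible morphism idempotent, hence an identity. The two kinds of braidings are never
    compared directly: each is determined by a family on homogeneous objects, and the bijection
    passes through these families. *)

Lemma id_comp X Y (f : hom X Y) : idm Y ∘ f = f.
Proof. exact: comp1m (tc_linear C) _ _ f. Qed.
Lemma comp_id X Y (f : hom X Y) : f ∘ idm X = f.
Proof. exact: compm1 (tc_linear C) _ _ f. Qed.
Lemma comp_assoc X Y Z T (h : hom Z T) (g : hom Y Z) (f : hom X Y) :
  (h ∘ g) ∘ f = h ∘ (g ∘ f).
Proof. by rewrite (compA (tc_linear C)). Qed.
Lemma ten_id X Y : idm X ⊠ idm Y = idm (X ⊗ Y).
Proof. exact: tenm1 (tc_bifunctor C) X Y. Qed.
Lemma ten_comp X X' X'' Y Y' Y'' (f' : hom X' X'') (f : hom X X')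
    (g' : hom Y' Y'') (g : hom Y Y') :
  (f' ⊠ g') ∘ (f ⊠ g) = (f' ∘ f) ⊠ (g' ∘ g).
Proof. by rewrite (tenm_comp (tc_bifunctor C)). Qed.
Lemma assoc_bwdK X Y Z : assocV X Y Z ∘ assoc X Y Z = idm _.
Proof. exact: assocK (tc_assoc C) X Y Z. Qed.
Lemma assoc_fwdK X Y Z : assoc X Y Z ∘ assocV X Y Z = idm _.
Proof. exact: assocVK (tc_assoc C) X Y Z. Qed.
Lemma assocV_nat X X' Y Y' Z Z' (f : hom X X') (g : hom Y Y') (h : hom Z Z') :
  assocV X' Y' Z' ∘ ((f ⊠ g) ⊠ h) = (f ⊠ (g ⊠ h)) ∘ assocV X Y Z.
Proof.
rewrite -[LHS]comp_id -(assoc_fwdK X Y Z) comp_assoc -(comp_assoc _ (assoc _ _ _)).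
by rewrite -(assoc_nat (tc_assoc C)) -!comp_assoc assoc_bwdK id_comp.
Qed.

Lemma whisker_comp X Y Y' Y'' (g : hom Y' Y'') (f : hom Y Y') :
  X ◁ (g ∘ f) = (X ◁ g) ∘ (X ◁ f).
Proof. by rewrite ten_comp id_comp. Qed.
Lemma comp_whisker X Y Y' Y'' (g : hom Y' Y'') (f : hom Y Y') :
  (g ∘ f) ▷ X = (g ▷ X) ∘ (f ▷ X).
Proof. by rewrite ten_comp id_comp. Qed.
Lemma interchange X X' Y Y' (f : hom X X') (g : hom Y Y') :
  (f ▷ Y') ∘ (X ◁ g) = (X' ◁ g) ∘ (f ▷ Y).
Proof. by rewrite !ten_comp !id_comp !comp_id. Qed.
Lemma ten_split X X' Y Y' (f : hom X X') (g : hom Y Y') :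
  f ⊠ g = (f ▷ Y') ∘ (X ◁ g).
Proof. by rewrite ten_comp id_comp comp_id. Qed.

Lemma comp_eq X Y Z T (f : hom Z T) (g : hom Y Z) (h : hom Y T) (x : hom X Y) :
  f ∘ g = h -> f ∘ (g ∘ x) = h ∘ x.
Proof. by move <-; rewrite comp_assoc. Qed.

Lemma eqhom_refl X (E : X = X) : eqhom E = idm X.
Proof. by rewrite (Prop_irrelevance E erefl). Qed.
Lemma eqhom_irr X Y (E E' : X = Y) : eqhom E = eqhom E'.
Proof. by rewrite (Prop_irrelevance E E'). Qed.
Lemma eqhom_comp X Y Z (E : X = Y) (E' : Y = Z) :
  eqhom E' ∘ eqhom E = eqhom (etrans E E').
Proof. by case: Z / E'; rewrite /= id_comp; apply: eqhom_irr. Qed.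
Lemma eqhomK X Y (E : X = Y) : eqhom (esym E) ∘ eqhom E = idm X.
Proof. by rewrite eqhom_comp eqhom_refl. Qed.
Lemma eqhomVK X Y (E : X = Y) : eqhom E ∘ eqhom (esym E) = idm Y.
Proof. by rewrite eqhom_comp eqhom_refl. Qed.
Lemma eqhom_ten X Y X' Y' (E : X = X') (E' : Y = Y') :
  eqhom E ⊠ eqhom E' = eqhom (f_equal2 ten E E').
Proof. by case: X' / E; case: Y' / E'; rewrite ten_id eqhom_refl. Qed.

Lemma is_identity_eqhom X Y (E : X = Y) : is_identity (eqhom E).
Proof. by exists E. Qed.
Lemma is_identity_idm X : is_identity (idm X).
Proof. by exists erefl. Qed.
Lemma is_identity_comp X Y Z (f : hom X Y) (g : hom Y Z) :
  is_identity g -> is_identity f -> is_identity (g ∘ f).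
Proof. by case=> E' -> [E ->]; rewrite eqhom_comp; exists (etrans E E'). Qed.
Lemma is_identity_ten X Y X' Y' (f : hom X X') (g : hom Y Y') :
  is_identity f -> is_identity g -> is_identity (f ⊠ g).
Proof. by case=> E -> [E' ->]; rewrite eqhom_ten; apply: is_identity_eqhom. Qed.
Lemma is_identity_eq X Y (f g : hom X Y) : is_identity f -> is_identity g -> f = g.
Proof. by case=> E -> [E' ->]; apply: eqhom_irr. Qed.
Lemma is_identity_bwd X Y (f : hom X Y) (g : hom Y X) :
  g ∘ f = idm X -> is_identity f -> is_identity g.
Proof.
move=> gf [E Ef]; exists (esym E).
by rewrite -[LHS]comp_id -(eqhomVK E) -Ef -comp_assoc gf id_comp.
Qed.

Lemma same_refl X Y (f : hom X Y) : same_mor f f.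
Proof. by exists erefl, erefl; rewrite /= id_comp comp_id. Qed.
Lemma same_sym X Y X' Y' (f : hom X Y) (g : hom X' Y') :
  same_mor f g -> same_mor g f.
Proof.
case=> EX [EY]; case: X' / EX g => g; case: Y' / EY g => g /=.
by rewrite id_comp comp_id => <-; apply: same_refl.
Qed.
Lemma same_trans X Y X' Y' X'' Y'' (f : hom X Y) (g : hom X' Y') (h : hom X'' Y'') :
  same_mor f g -> same_mor g h -> same_mor f h.
Proof.
case=> EX [EY]; case: X' / EX g => g; case: Y' / EY g => g /=.
by rewrite id_comp comp_id => ->.
Qed.
Lemma same_eq X Y (f g : hom X Y) : same_mor f g -> f = g.
Proof. by case=> EX [EY]; rewrite !eqhom_refl id_comp comp_id. Qed.
Lemma same_comp X Y Z X' Y' Z' (g : hom Y Z) (f : hom X Y)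
    (g' : hom Y' Z') (f' : hom X' Y') :
  same_mor g g' -> same_mor f f' -> same_mor (g ∘ f) (g' ∘ f').
Proof.
move=> sg [EX [EY]]; case: X' / EX f' => f'; case: Y' / EY g' f' sg => g' f' sg /=.
rewrite id_comp comp_id => ->.
case: sg => EY [EZ]; case: Z' / EZ g' => g' /=.
by rewrite eqhom_refl id_comp comp_id => ->; apply: same_refl.
Qed.
Lemma same_comp_idl X Y Z X' Y' (g : hom Y Z) (f : hom X Y) (f' : hom X' Y') :
  is_identity g -> same_mor f f' -> same_mor (g ∘ f) f'.
Proof. by case=> E Eg; case: Z / E g Eg => g ->; rewrite /= id_comp. Qed.
Lemma same_comp_idr X Y Z X' Y' (g : hom Y Z) (f : hom X Y) (g' : hom X' Y') :
  is_identity f -> same_mor g g' -> same_mor (g ∘ f) g'.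
Proof. by case=> E Ef; case: Y / E f Ef g => f -> g; rewrite /= comp_id. Qed.

Lemma ten_unit_same X Y J J' (f : hom X Y) (g : hom J J') :
  is_identity g -> J = unit_ob C -> same_mor (f ⊠ g) f.
Proof.
case=> E Eg EJ; case: J' / E g Eg => g ->; rewrite EJ /=.
exact: (tenm1r (tc_unit C)).
Qed.
Lemma unit_ten_same X Y J J' (f : hom X Y) (g : hom J J') :
  is_identity g -> J = unit_ob C -> same_mor (g ⊠ f) f.
Proof.
case=> E Eg EJ; case: J' / E g Eg => g ->; rewrite EJ /=.
exact: (tenm1l (tc_unit C)).
Qed.

Lemma assoc_same X Y Z X' Y' Z' : X = X' -> Y = Y' -> Z = Z' ->
  same_mor (assoc X Y Z) (assoc X' Y' Z').
Proof. by move=> -> -> ->; apply: same_refl. Qed.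

End EqualityMorphisms.

(** * Unit constraints, including associativity with an outer unit factor *)

Section Units.
Variables (k : fieldType) (C : tensorCat k).
Implicit Types X Y Z J : ob C.

(** Cancelling one factor of f = f f by the left inverse [g] leaves an identity; [E] is what makes f
    f well typed. All outer unit cases, for [assoc] and for [om], reduce to this. *)
Lemma idempotent_identity X Y (f : hom X Y) (g : hom Y X) (E : Y = X) :
  g ∘ f = idm X -> same_mor f (f ∘ eqhom E ∘ f) -> is_identity f.
Proof.
case: X / E f g => f g gf /same_eq; rewrite /= comp_id => ff.
suff -> : f = idm Y by apply: is_identity_idm.
by rewrite -[LHS]id_comp -gf comp_assoc -ff.
Qed.

Lemma assoc_mid_identity X J Z : J = unit_ob C -> is_identity (assoc X J Z).
Proof. by move->; apply: assoc_unit (tc_unit C) X Z. Qed.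

(** In the pentagon at (I, I, X, Y) the associators with a middle I are identities, and the rest
    says that [assoc I X Y] is idempotent. *)
Lemma assoc_left_identity J X Y : J = unit_ob C -> is_identity (assoc J X Y).
Proof.
move=> ->; set I := unit_ob C; have u1 := ten1l (tc_unit C).
have E : I ⊗ X ⊗ Y = I ⊗ (X ⊗ Y) by rewrite !u1.
apply: (idempotent_identity (E := E) (assoc_bwdK _ _ _)).
have idI := is_identity_idm I.
have lhs : same_mor (assoc I X Y) (assoc (I ⊗ I) X Y ∘ assoc I I (X ⊗ Y)).
  by apply/same_sym/same_comp_idr; [apply: assoc_mid_identity|apply: assoc_same; rewrite ?u1].
apply: (same_trans lhs); rewrite (pentagon (tc_assoc C)).
apply: same_comp; last by apply: unit_ten_same.
apply: (same_trans (g := assoc I (I ⊗ X) Y)).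
  apply: same_comp_idl; last exact: same_refl.
  by apply: is_identity_ten; [apply: assoc_mid_identity|apply: is_identity_idm].
apply/same_sym/same_comp_idr; first exact: is_identity_eqhom.
by apply: assoc_same; rewrite ?u1.
Qed.

(** The pentagon at (X, Y, I, I) has the same effect on [assoc X Y I]. *)
Lemma assoc_right_identity X Y J : J = unit_ob C -> is_identity (assoc X Y J).
Proof.
move=> ->; set I := unit_ob C; have u1 := ten1r (tc_unit C).
have E : X ⊗ Y ⊗ I = X ⊗ (Y ⊗ I) by rewrite !u1.
apply: (idempotent_identity (E := E) (assoc_bwdK _ _ _)).
have idI := is_identity_idm I.
have lhs : same_mor (assoc X Y I) (assoc (X ⊗ Y) I I ∘ assoc X Y (I ⊗ I)).
  apply/same_sym/same_comp_idl; first exact: assoc_mid_identity.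
  by apply: assoc_same; rewrite ?u1.
apply: (same_trans lhs); rewrite (pentagon (tc_assoc C)).
rewrite !comp_assoc.
apply: same_comp; first by apply: ten_unit_same.
apply: (same_trans (g := assoc X (Y ⊗ I) I)).
  apply: same_comp_idr; last exact: same_refl.
  by apply: is_identity_ten; [apply: is_identity_idm|apply: assoc_mid_identity].
apply/same_sym/same_comp_idl; first exact: is_identity_eqhom.
by apply: assoc_same; rewrite ?u1.
Qed.

Lemma assocV_left_identity J X Y : J = unit_ob C -> is_identity (assocV J X Y).
Proof. by move=> E; apply: is_identity_bwd (assoc_bwdK _ _ _) (assoc_left_identity X Y E). Qed.
Lemma assocV_mid_identity X J Y : J = unit_ob C -> is_identity (assocV X J Y).
Proof. by move=> E; apply: is_identity_bwd (assoc_bwdK _ _ _) (assoc_mid_identity X Y E). Qed.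
Lemma assocV_right_identity X Y J : J = unit_ob C -> is_identity (assocV X Y J).
Proof. by move=> E; apply: is_identity_bwd (assoc_bwdK _ _ _) (assoc_right_identity X Y E). Qed.

Lemma unit_ten_ob J X : J = unit_ob C -> J ⊗ X = X.
Proof. by move->; rewrite (ten1l (tc_unit C)). Qed.
Lemma ten_unit_ob J X : J = unit_ob C -> X ⊗ J = X.
Proof. by move->; rewrite (ten1r (tc_unit C)). Qed.

(** The unit enters as any [J] with a proof [E] that it equals I, so that $U_{1,s}$ and $U_{s,1}$
    have unit maps of their own. *)
Definition lun J (E : J = unit_ob C) X : hom (J ⊗ X) X := eqhom (unit_ten_ob X E).
Definition lunV J (E : J = unit_ob C) X : hom X (J ⊗ X) :=
  eqhom (esym (unit_ten_ob X E)).
Definition run J (E : J = unit_ob C) X : hom (X ⊗ J) X := eqhom (ten_unit_ob X E).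
Definition runV J (E : J = unit_ob C) X : hom X (X ⊗ J) :=
  eqhom (esym (ten_unit_ob X E)).

Lemma lun_nat J (E : J = unit_ob C) X Y (f : hom X Y) :
  lun E Y ∘ (J ◁ f) = f ∘ lun E X.
Proof.
apply: same_eq; apply: (same_trans (g := f)).
  apply: same_comp_idl; first exact: is_identity_eqhom.
  by apply: unit_ten_same => //; apply: is_identity_idm.
by apply/same_sym/same_comp_idr; [apply: is_identity_eqhom|apply: same_refl].
Qed.

Lemma run_nat J (E : J = unit_ob C) X Y (f : hom X Y) :
  run E Y ∘ (f ▷ J) = f ∘ run E X.
Proof.
apply: same_eq; apply: (same_trans (g := f)).
  apply: same_comp_idl; first exact: is_identity_eqhom.
  by apply: ten_unit_same => //; apply: is_identity_idm.
by apply/same_sym/same_comp_idr; [apply: is_identity_eqhom|apply: same_refl].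
Qed.

Lemma lunK J (E : J = unit_ob C) X : lunV E X ∘ lun E X = idm _.
Proof. exact: eqhomK. Qed.
Lemma lunVK J (E : J = unit_ob C) X : lun E X ∘ lunV E X = idm _.
Proof. exact: eqhomVK. Qed.
Lemma runK J (E : J = unit_ob C) X : runV E X ∘ run E X = idm _.
Proof. exact: eqhomK. Qed.
Lemma runVK J (E : J = unit_ob C) X : run E X ∘ runV E X = idm _.
Proof. exact: eqhomVK. Qed.

End Units.

(** * Strictification *)

(* A bracketed word [a] acts on objects by
   T |-> X1 (X2 (... (Xn T))), where the letters equal to I are omitted; this
   action is strictly associative and unital.  A morphism f : a -> b thus gives
   a natural family [strict f T] : nf a T -> nf b T, in which all associativity
   and unit constraints become identities. *)
Section Strict.
Variables (k : fieldType) (C : tensorCat k).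
Implicit Types X Y Z J T : ob C.

Inductive word : Type :=
  | Un J of J = unit_ob C
  | At of ob C
  | Ten of word & word.

Fixpoint ev (a : word) : ob C :=
  match a with Un J _ => J | At X => X | Ten a b => ev a ⊗ ev b end.

Fixpoint nf (a : word) (T : ob C) : ob C :=
  match a with Un _ _ => T | At X => X ⊗ T | Ten a b => nf a (nf b T) end.

Fixpoint nfm (a : word) T T' (h : hom T T') : hom (nf a T) (nf a T') :=
  match a with
  | Un _ _ => h
  | At X => X ◁ h
  | Ten a b => nfm a (nfm b h)
  end.

Fixpoint fl (a : word) T : hom (ev a ⊗ T) (nf a T) :=
  match a with
  | Un J E => lun E T
  | At X => idm (X ⊗ T)
  | Ten a b => fl a (nf b T) ∘ (ev a ◁ fl b T) ∘ assocV (ev a) (ev b) T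
  end.

Fixpoint flV (a : word) T : hom (nf a T) (ev a ⊗ T) :=
  match a with
  | Un J E => lunV E T
  | At X => idm (X ⊗ T)
  | Ten a b => assoc (ev a) (ev b) T ∘ (ev a ◁ flV b T) ∘ flV a (nf b T)
  end.

Lemma flK a T : flV a T ∘ fl a T = idm _.
Proof.
elim: a T => [J E|X|a IHa b IHb] T /=; [exact: lunK|exact: id_comp|].
rewrite !comp_assoc -(comp_assoc (flV a _)) IHa id_comp.
by rewrite -(comp_assoc (_ ◁ _)) -whisker_comp IHb ten_id id_comp assoc_fwdK.
Qed.

Lemma flVK a T : fl a T ∘ flV a T = idm _.
Proof.
elim: a T => [J E|X|a IHa b IHb] T /=; [exact: lunVK|exact: id_comp|].
rewrite !comp_assoc -(comp_assoc (assocV _ _ _)) assoc_bwdK id_comp.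
by rewrite -(comp_assoc (_ ◁ _)) -whisker_comp IHb ten_id id_comp IHa.
Qed.

Lemma nfm_id a T : nfm a (idm T) = idm _.
Proof.
elim: a T => [J E|X|a IHa b IHb] T //=; first by rewrite ten_id.
by rewrite IHb IHa.
Qed.

Lemma fl_nat a T T' (h : hom T T') : fl a T' ∘ (ev a ◁ h) = nfm a h ∘ fl a T.
Proof.
elim: a T T' h => [J E|X|a IHa b IHb] T T' h /=.
- exact: lun_nat.
- by rewrite id_comp comp_id.
rewrite comp_assoc -(ten_id (ev a)) assocV_nat -!comp_assoc; congr (_ ∘ _).
by rewrite comp_assoc -whisker_comp IHb whisker_comp -comp_assoc IHa.
Qed.

Fact strict_key : unit. Proof. by []. Qed.

(** The map [f ▷ T] conjugated by the flattening isomorphisms. The lock keeps conversion from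
    computing the body. *)
Definition strict (a b : word) (f : hom (ev a) (ev b)) T : hom (nf a T) (nf b T) :=
  locked_with strict_key (fl b T ∘ (f ▷ T) ∘ flV a T).

Lemma strictE a b (f : hom (ev a) (ev b)) T :
  fl b T ∘ (f ▷ T) = strict f T ∘ fl a T.
Proof. by rewrite /strict unlock comp_assoc flK comp_id. Qed.

Lemma strict_unique a b (f : hom (ev a) (ev b)) T g :
  fl b T ∘ (f ▷ T) = g ∘ fl a T -> strict f T = g.
Proof. by move=> e; rewrite /strict unlock e comp_assoc flVK comp_id. Qed.

(** At T = I, naturality of [run] recovers f from f ▷ I. *)
Lemma strict_inj a b (f g : hom (ev a) (ev b)) :
  (forall T, strict f T = strict g T) -> f = g.
Proof.
move=> eqS; pose T := unit_ob C.
have e : f ▷ T = g ▷ T.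
  by rewrite -[LHS]id_comp -(flK b) comp_assoc strictE eqS -strictE -comp_assoc flK id_comp.
have E := erefl T.
by rewrite -[f]comp_id -(runVK E (ev a)) -comp_assoc -run_nat e run_nat comp_assoc runVK comp_id.
Qed.

Lemma strict_nat a b (f : hom (ev a) (ev b)) T T' (h : hom T T') :
  strict f T' ∘ nfm a h = nfm b h ∘ strict f T.
Proof.
rewrite -[LHS]comp_id -(flVK a) -comp_assoc (comp_assoc (strict _ _)) -fl_nat.
rewrite -(comp_assoc (strict _ _)) -strictE (comp_assoc (fl _ _)) interchange.
by rewrite -(comp_assoc (fl _ _)) fl_nat /strict !unlock !comp_assoc.
Qed.

Lemma strict_id a T : strict (idm (ev a)) T = idm _.
Proof. by apply: strict_unique; rewrite ten_id comp_id id_comp. Qed.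

Lemma strict_comp a b d (g : hom (ev b) (ev d)) (f : hom (ev a) (ev b)) T :
  strict (a := a) (b := d) (g ∘ f) T = strict g T ∘ strict f T.
Proof.
apply: strict_unique.
by rewrite comp_whisker -comp_assoc strictE comp_assoc strictE comp_assoc.
Qed.

(** The right factor acts first, below the letters of [a]; [strict_nat] exchanges the two
    factors. *)
Lemma strict_ten a a' b b' (f : hom (ev a) (ev a')) (g : hom (ev b) (ev b')) T :
  strict (a := Ten a b) (b := Ten a' b') (f ⊠ g) T =
  strict f (nf b' T) ∘ nfm a (strict g T).
Proof.
apply: strict_unique => /=; rewrite comp_assoc assocV_nat -!comp_assoc.
congr (_ ∘ _); rewrite comp_assoc ten_comp id_comp strictE.
rewrite ten_split whisker_comp -!comp_assoc strictE; congr (_ ∘ _).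
by rewrite !comp_assoc fl_nat.
Qed.

(** The pentagon, solved for [assoc ▷ T], expresses it as the difference between the flattenings of
    the two bracketings. *)
Lemma strict_assoc a b d T :
  strict (a := Ten a (Ten b d)) (b := Ten (Ten a b) d) (assoc (ev a) (ev b) (ev d)) T
  = idm _.
Proof.
apply: strict_unique => /=; rewrite id_comp.
have pent : assoc (ev a) (ev b) (ev d) ▷ T = assoc (ev a ⊗ ev b) (ev d) T
    ∘ assoc (ev a) (ev b) (ev d ⊗ T) ∘ (ev a ◁ assocV (ev b) (ev d) T)
    ∘ assocV (ev a) (ev b ⊗ ev d) T.
  rewrite (pentagon (tc_assoc C)) !comp_assoc -(comp_assoc (ev a ◁ _)).
  by rewrite -whisker_comp assoc_fwdK ten_id id_comp assoc_fwdK comp_id.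
rewrite pent !comp_assoc -(ten_id (ev a) (ev b)).
rewrite -(comp_assoc (assocV _ _ _) (assoc _ _ _)) assoc_bwdK id_comp.
rewrite -(comp_assoc (assocV _ _ _) ((_ ⊠ _) ⊠ _)) assocV_nat !comp_assoc.
rewrite -(comp_assoc (assocV _ _ _) (assoc _ _ _)) assoc_bwdK id_comp.
by rewrite !whisker_comp !comp_assoc.
Qed.

Lemma strict_bwd a b (f : hom (ev a) (ev b)) (g : hom (ev b) (ev a)) T :
  g ∘ f = idm _ -> strict g T ∘ strict f T = idm _.
Proof. by move=> gf; rewrite -(strict_comp (a := a) (b := b) (d := a)) gf strict_id. Qed.

Lemma strict_assocV a b d T :
  strict (a := Ten (Ten a b) d) (b := Ten a (Ten b d)) (assocV (ev a) (ev b) (ev d)) T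
  = idm _.
Proof.
have := strict_bwd (a := Ten a (Ten b d)) (b := Ten (Ten a b) d) T (assoc_bwdK _ _ _).
by rewrite strict_assoc comp_id.
Qed.

Lemma strict_lun J (E : J = unit_ob C) a T :
  strict (a := Ten (Un E) a) (b := a) (lun E (ev a)) T = idm _.
Proof.
apply: strict_unique => /=; rewrite id_comp lun_nat comp_assoc; congr (_ ∘ _).
apply: is_identity_eq.
  by apply: is_identity_ten; [apply: is_identity_eqhom|apply: is_identity_idm].
by apply: is_identity_comp; [apply: is_identity_eqhom|apply: assocV_left_identity].
Qed.

Lemma strict_run J (E : J = unit_ob C) a T :
  strict (a := Ten a (Un E)) (b := a) (run E (ev a)) T = idm _.
Proof.
apply: strict_unique => /=; rewrite id_comp comp_assoc; congr (_ ∘ _).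
apply: is_identity_eq.
  by apply: is_identity_ten; [apply: is_identity_eqhom|apply: is_identity_idm].
apply: is_identity_comp; last exact: assocV_mid_identity.
by apply: is_identity_ten; [apply: is_identity_idm|apply: is_identity_eqhom].
Qed.

Lemma strict_lunV J (E : J = unit_ob C) a T :
  strict (a := a) (b := Ten (Un E) a) (lunV E (ev a)) T = idm _.
Proof.
have := strict_bwd (a := Ten (Un E) a) (b := a) T (lunK E (ev a)).
by rewrite strict_lun comp_id.
Qed.

Lemma strict_runV J (E : J = unit_ob C) a T :
  strict (a := a) (b := Ten a (Un E)) (runV E (ev a)) T = idm _.
Proof.
have := strict_bwd (a := Ten a (Un E)) (b := a) T (runK E (ev a)).
by rewrite strict_run comp_id.
Qed.

(* Reified morphisms: [stm m] is [strict (evm m)] with all structural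
   isomorphisms erased. *)
Inductive mor : word -> word -> Type :=
  | Atom a b of hom (ev a) (ev b) : mor a b
  | Id a : mor a a
  | Comp a b d of mor b d & mor a b : mor a d
  | Tens a a' b b' of mor a a' & mor b b' : mor (Ten a b) (Ten a' b')
  | As a b d : mor (Ten a (Ten b d)) (Ten (Ten a b) d)
  | AsV a b d : mor (Ten (Ten a b) d) (Ten a (Ten b d))
  | Lu J (E : J = unit_ob C) a : mor (Ten (Un E) a) a
  | LuV J (E : J = unit_ob C) a : mor a (Ten (Un E) a)
  | Ru J (E : J = unit_ob C) a : mor (Ten a (Un E)) a
  | RuV J (E : J = unit_ob C) a : mor a (Ten a (Un E)).

Fixpoint evm a b (m : mor a b) : hom (ev a) (ev b) :=
  match m in mor a b return hom (ev a) (ev b) with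
  | Atom a b f => f
  | Id a => idm (ev a)
  | Comp a b d g f => evm g ∘ evm f
  | Tens a a' b b' f g => evm f ⊠ evm g
  | As a b d => assoc (ev a) (ev b) (ev d)
  | AsV a b d => assocV (ev a) (ev b) (ev d)
  | Lu J E a => lun E (ev a)
  | LuV J E a => lunV E (ev a)
  | Ru J E a => run E (ev a)
  | RuV J E a => runV E (ev a)
  end.

Fixpoint stm a b (m : mor a b) T : hom (nf a T) (nf b T) :=
  match m in mor a b return hom (nf a T) (nf b T) with
  | Atom a b f => strict f T
  | Id a => idm (nf a T)
  | Comp a b d g f => stm g T ∘ stm f T
  | Tens a a' b b' f g => stm f (nf b' T) ∘ nfm a (stm g T)
  | As a b d => idm (nf a (nf b (nf d T)))
  | AsV a b d => idm (nf a (nf b (nf d T)))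
  | Lu J E a => idm (nf a T)
  | LuV J E a => idm (nf a T)
  | Ru J E a => idm (nf a T)
  | RuV J E a => idm (nf a T)
  end.

Lemma stmE a b (m : mor a b) T : strict (evm m) T = stm m T.
Proof.
elim: m T => {a b} /=.
- by [].
- exact: strict_id.
- by move=> a b d g IHg f IHf T; rewrite strict_comp IHg IHf.
- by move=> a a' b b' f IHf g IHg T; rewrite strict_ten IHg IHf.
- exact: strict_assoc.
- exact: strict_assocV.
- exact: strict_lun.
- exact: strict_lunV.
- exact: strict_run.
- exact: strict_runV.
Qed.

Lemma eq_from_strict a b (m m' : mor a b) :
  (forall T, stm m T = stm m' T) -> evm m = evm m'.
Proof. by move=> e; apply: strict_inj => T; rewrite !stmE. Qed.

Lemma strict_from_eq a b (m m' : mor a b) T : evm m = evm m' -> stm m T = stm m' T.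
Proof. by rewrite -!stmE => ->. Qed.

End Strict.

(** * Reification of objects and morphisms, with $U_{1,s}$ and $U_{s,1}$ read as units *)

Section TrivialObjects.
Variables (k : fieldType) (G : groupType) (C : tensorCat k).
Variable A : centralOuterAction G C.
Local Open Scope group_scope.

Lemma cU1l_ob s : zob (cU A 1 s) = unit_ob C.
Proof. by have [] := cU1l A s. Qed.
Lemma cU1r_ob s : zob (cU A s 1) = unit_ob C.
Proof. by have [] := cU1r A s. Qed.
End TrivialObjects.

(** Objects read as [Un] vanish from normal forms. $U_{1,1}$ fits two patterns and is read through
    [cU1l_ob]. *)
Ltac reify_word C X :=
  lazymatch X with
  | ten ?a ?b =>
    let a' := reify_word C a in let b' := reify_word C b in constr:(Ten a' b')
  | ev ?a => a
  | unit_ob _ => constr:(@Un _ C (unit_ob C) erefl)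
  | zob (cU ?A 1%g ?s) => constr:(@Un _ C _ (cU1l_ob A s))
  | zob (cU ?A ?s 1%g) => constr:(@Un _ C _ (cU1r_ob A s))
  | _ => constr:(@At _ C X)
  end.

(** A morphism of unknown shape becomes an [Atom], whose source and target words are read off its
    type. *)
Ltac reify_mor C f :=
  lazymatch f with
  | idm ?X => let a := reify_word C X in constr:(@Id _ C a)
  | comp ?g ?h =>
    let g' := reify_mor C g in let h' := reify_mor C h in constr:(Comp g' h')
  | tenm ?g ?h =>
    let g' := reify_mor C g in let h' := reify_mor C h in constr:(Tens g' h')
  | assoc ?X ?Y ?Z =>
    let a := reify_word C X in let b := reify_word C Y in
    let d := reify_word C Z in constr:(@As _ C a b d)
  | assocV ?X ?Y ?Z =>
    let a := reify_word C X in let b := reify_word C Y in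
    let d := reify_word C Z in constr:(@AsV _ C a b d)
  | lun ?E ?X => let a := reify_word C X in constr:(@Lu _ C _ E a)
  | lunV ?E ?X => let a := reify_word C X in constr:(@LuV _ C _ E a)
  | run ?E ?X => let a := reify_word C X in constr:(@Ru _ C _ E a)
  | runV ?E ?X => let a := reify_word C X in constr:(@RuV _ C _ E a)
  | _ =>
    let ty := type of f in
    lazymatch ty with
    | context [hom ?X ?Y] =>
      let a := reify_word C X in let b := reify_word C Y in
      constr:(@Atom _ C a b f)
    end
  end.

Ltac strict_goal C :=
  lazymatch goal with
  | |- ?f = ?g =>
    let f' := reify_mor C f in let g' := reify_mor C g in
    refine (@eq_from_strict _ C _ _ f' g' _);
    let T := fresh "T" in intro T; cbn [stm nf nfm]
  end.

Ltac strict_hyp C H T :=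
  lazymatch type of H with
  | ?f = ?g =>
    let f' := reify_mor C f in let g' := reify_mor C g in
    let H' := fresh H "S" in
    have H' := @strict_from_eq _ C _ _ f' g' T H;
    cbn [stm nf nfm] in H'
  end.

(** * Braidings of the action give braidings on homogeneous objects *)

Section StrictBraiding.
Variables (k : fieldType) (C : tensorCat k) (c : braiding C).
Implicit Types X Y Z T : ob C.

Lemma strict_At X Y (f : hom X Y) T : strict (a := At X) (b := At Y) f T = f ▷ T.
Proof. by rewrite /strict unlock /= id_comp comp_id. Qed.

Definition brS X Y T : hom (X ⊗ (Y ⊗ T)) (Y ⊗ (X ⊗ T)) :=
  @strict _ C (Ten (At X) (At Y)) (Ten (At Y) (At X)) (fwd (br c X Y)) T.

Lemma brS_nat X Y T T' (h : hom T T') :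
  brS X Y T' ∘ (X ◁ (Y ◁ h)) = (Y ◁ (X ◁ h)) ∘ brS X Y T.
Proof. exact: (@strict_nat _ C (Ten (At X) (At Y)) (Ten (At Y) (At X))). Qed.

Lemma brS_natl X X' Y T (f : hom X X') :
  brS X' Y T ∘ (f ▷ (Y ⊗ T)) = (Y ◁ (f ▷ T)) ∘ brS X Y T.
Proof.
have H := br_nat c f (idm Y); strict_hyp C H T.
by move: HS; rewrite !strict_At ?(ten_id, comp_id, id_comp).
Qed.

(** The first hexagon with its associators erased. It is stated for words because the factors will
    also be products or I. *)
Lemma brS_tenl a b d T :
  strict (a := Ten (Ten a b) d) (b := Ten d (Ten a b))
    (fwd (br c (ev a ⊗ ev b) (ev d))) T
  = strict (a := Ten a d) (b := Ten d a) (fwd (br c (ev a) (ev d))) (nf b T)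
    ∘ nfm a (strict (a := Ten b d) (b := Ten d b) (fwd (br c (ev b) (ev d))) T).
Proof.
have H := br_hexagon1 c (ev a) (ev b) (ev d); strict_hyp C H T.
by move: HS; rewrite ?(nfm_id, comp_id, id_comp).
Qed.

Lemma brS_tenr a b d T :
  strict (a := Ten a (Ten b d)) (b := Ten (Ten b d) a)
    (fwd (br c (ev a) (ev b ⊗ ev d))) T
  = nfm b (strict (a := Ten a d) (b := Ten d a) (fwd (br c (ev a) (ev d))) T)
    ∘ strict (a := Ten a b) (b := Ten b a) (fwd (br c (ev a) (ev b))) (nf d T).
Proof.
have H := br_hexagon2 c (ev a) (ev b) (ev d); strict_hyp C H T.
by move: HS; rewrite ?(nfm_id, comp_id, id_comp).
Qed.

(* The two ways to twist c by a monoidal automorphism u of the identity functor;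
   each satisfies only one of the hexagons. *)
Definition brl (u : monNatAut C) X Y : hom (X ⊗ Y) (Y ⊗ X) :=
  fwd (br c X Y) ∘ (fwd (u X) ▷ Y).

Definition brr (u : monNatAut C) X Y : hom (X ⊗ Y) (Y ⊗ X) :=
  fwd (br c X Y) ∘ (X ◁ fwd (u Y)).

(** Monoidality splits [u] over X ⊗ Y, and the part on X slides past the braiding of Y with Z. *)
Lemma brl_hexagon u X Y Z :
  assoc Z X Y ∘ brl u (X ⊗ Y) Z ∘ assoc X Y Z =
  (brl u X Z ▷ Y) ∘ assoc X Z Y ∘ (X ◁ brl u Y Z).
Proof.
rewrite /brl na_ten; strict_goal C.
rewrite ?(ten_id, comp_id, id_comp, strict_At, whisker_comp, comp_assoc).
rewrite (brS_tenl (At X) (At Y) (At Z)) /= !comp_assoc; congr (_ ∘ _).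
by rewrite -!comp_assoc interchange.
Qed.

Lemma brr_hexagon u X Y Z :
  assocV Y Z X ∘ brr u X (Y ⊗ Z) ∘ assocV X Y Z =
  (Y ◁ brr u X Z) ∘ assocV Y X Z ∘ (brr u X Y ▷ Z).
Proof.
rewrite /brr na_ten; strict_goal C.
rewrite ?(ten_id, comp_id, id_comp, strict_At, whisker_comp, comp_assoc).
rewrite (brS_tenr (At X) (At Y) (At Z)) /= !comp_assoc; congr (_ ∘ _).
rewrite -[RHS]comp_assoc -/(brS _ _ _) -brS_nat comp_assoc; congr (_ ∘ _).
by rewrite -!whisker_comp interchange.
Qed.

Lemma brl_natr u X Y Y' (f : hom Y Y') :
  (f ▷ X) ∘ brl u X Y = brl u X Y' ∘ (X ◁ f).
Proof. by rewrite /brl -comp_assoc -br_nat !comp_assoc interchange. Qed.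

Lemma brr_natl u X X' Y (f : hom X X') :
  (Y ◁ f) ∘ brr u X Y = brr u X' Y ∘ (f ▷ Y).
Proof. by rewrite /brr -comp_assoc -br_nat !comp_assoc interchange. Qed.

Lemma brrS_natl u X X' Y (f : hom X X') T :
  (Y ◁ (f ▷ T)) ∘ strict (a := Ten (At X) (At Y)) (b := Ten (At Y) (At X)) (brr u X Y) T
  = strict (a := Ten (At X') (At Y)) (b := Ten (At Y) (At X')) (brr u X' Y) T
    ∘ (f ▷ (Y ⊗ T)).
Proof.
have H := brr_natl u Y f; strict_hyp C H T.
by move: HS; rewrite !strict_At !(ten_id, id_comp, comp_id).
Qed.

Lemma brlS_natr u X Y Y' (f : hom Y Y') T :
  (f ▷ (X ⊗ T)) ∘ strict (a := Ten (At X) (At Y)) (b := Ten (At Y) (At X)) (brl u X Y) T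
  = strict (a := Ten (At X) (At Y')) (b := Ten (At Y') (At X)) (brl u X Y') T
    ∘ (X ◁ (f ▷ T)).
Proof.
have H := brl_natr u X f; strict_hyp C H T.
by move: HS; rewrite !strict_At !(ten_id, id_comp, comp_id).
Qed.

Lemma brlS_ten u a b d T :
  strict (a := Ten (Ten a b) d) (b := Ten d (Ten a b)) (brl u (ev a ⊗ ev b) (ev d)) T
  = strict (a := Ten a d) (b := Ten d a) (brl u (ev a) (ev d)) (nf b T)
    ∘ nfm a (strict (a := Ten b d) (b := Ten d b) (brl u (ev b) (ev d)) T).
Proof.
have H := brl_hexagon u (ev a) (ev b) (ev d); strict_hyp C H T.
by move: HS; rewrite ?(nfm_id, comp_id, id_comp).
Qed.

Lemma brrS_ten u a b d T :
  strict (a := Ten a (Ten b d)) (b := Ten (Ten b d) a) (brr u (ev a) (ev b ⊗ ev d)) T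
  = nfm b (strict (a := Ten a d) (b := Ten d a) (brr u (ev a) (ev d)) T)
    ∘ strict (a := Ten a b) (b := Ten b a) (brr u (ev a) (ev b)) (nf d T).
Proof.
have H := brr_hexagon u (ev a) (ev b) (ev d); strict_hyp C H T.
by move: HS; rewrite ?(nfm_id, comp_id, id_comp).
Qed.

End StrictBraiding.

(** * Families on homogeneous objects, with named products of degrees *)

Section Homogeneous.
Variables (k : fieldType) (G : groupType) (C : tensorCat k).
Hypothesis mulGC : forall s t : G, (s * t = t * s)%g.
Variables (c : braiding C) (A : centralOuterAction G C).
Local Open Scope group_scope.
Local Notation U := (cU A).
Implicit Types (V W X Y Z T : ob C) (s t r : G).

(* The constraints omega_{s,t,r} and the associativity of the crossed product,
   with names for the products [s * t] and [t * r]: this makes the casts along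
   equalities in G disappear. *)
Definition omg s t r st tr (E1 : s * t = st) (E2 : t * r = tr) :
    hom (U t r ⊗ U s tr) (U s t ⊗ U st r) :=
  match E1 in _ = st, E2 in _ = tr
    return hom (U t r ⊗ U s tr) (U s t ⊗ U st r) with
  | erefl, erefl => fwd (om A s t r)
  end.

Definition omgV s t r st tr (E1 : s * t = st) (E2 : t * r = tr) :
    hom (U s t ⊗ U st r) (U t r ⊗ U s tr) :=
  match E1 in _ = st, E2 in _ = tr
    return hom (U s t ⊗ U st r) (U t r ⊗ U s tr) with
  | erefl, erefl => bwd (om A s t r)
  end.

Definition hassoc V W Z s t r st tr (E1 : s * t = st) (E2 : t * r = tr) :
    hom (V ⊗ (W ⊗ Z ⊗ U t r) ⊗ U s tr) (V ⊗ W ⊗ U s t ⊗ Z ⊗ U st r) :=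
  (assoc (V ⊗ W) (U s t) Z ▷ U st r)
  ∘ ((V ⊗ W ◁ fwd (zbr (U s t) Z)) ▷ U st r)
  ∘ (assocV (V ⊗ W) Z (U s t) ▷ U st r)
  ∘ assoc (V ⊗ W ⊗ Z) (U s t) (U st r)
  ∘ (V ⊗ W ⊗ Z ◁ omg E1 E2)
  ∘ assocV (V ⊗ W ⊗ Z) (U t r) (U s tr)
  ∘ ((assoc V W Z ▷ U t r) ▷ U s tr)
  ∘ (assoc V (W ⊗ Z) (U t r) ▷ U s tr).

Definition hassocV V W Z s t r st tr (E1 : s * t = st) (E2 : t * r = tr) :
    hom (V ⊗ W ⊗ U s t ⊗ Z ⊗ U st r) (V ⊗ (W ⊗ Z ⊗ U t r) ⊗ U s tr) :=
  (assocV V (W ⊗ Z) (U t r) ▷ U s tr)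
  ∘ ((assocV V W Z ▷ U t r) ▷ U s tr)
  ∘ assoc (V ⊗ W ⊗ Z) (U t r) (U s tr)
  ∘ (V ⊗ W ⊗ Z ◁ omgV E1 E2)
  ∘ assocV (V ⊗ W ⊗ Z) (U s t) (U st r)
  ∘ (assoc (V ⊗ W) Z (U s t) ▷ U st r)
  ∘ ((V ⊗ W ◁ bwd (zbr (U s t) Z)) ▷ U st r)
  ∘ (assocV (V ⊗ W) (U s t) Z ▷ U st r).

Definition hfamily := forall V s W t, hom (V ⊗ W ⊗ U s t) (W ⊗ V ⊗ U t s).
Implicit Type b : hfamily.

Definition hnatural b := forall V V' W W' s t (f : hom V V') (g : hom W W'),
  b V' s W' t ∘ (f ⊠ g ⊠ idm (U s t)) = (g ⊠ f ⊠ idm (U t s)) ∘ b V s W t.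

(** Commutativity of G takes the form of two equations for one variable, such as [E2] and [E2']. At
    s = 1 the name [st] can be s itself, through [mul1g], so that no index 1 * s appears. *)
Definition hhexagon1 b := forall V W Z s t r st tr rs
    (E1 : s * t = st) (E2 : t * r = tr) (E2' : r * t = tr)
    (E3 : r * s = rs) (E3' : s * r = rs),
  hassoc Z V W E3 E1 ∘ b (V ⊗ W ⊗ U s t) st Z r ∘ hassoc V W Z E1 E2
  = (b V s Z r ⊠ idm W ⊠ idm (U rs t)) ∘ hassoc V Z W E3' E2'
    ∘ (idm V ⊠ b W t Z r ⊠ idm (U s tr)).

Definition hhexagon2 b := forall V W Z s t r st tr rs
    (E1 : s * t = st) (E1' : t * s = st) (E2 : t * r = tr)
    (E3 : r * s = rs) (E3' : s * r = rs),
  hassocV W Z V E2 E3 ∘ b V s (W ⊗ Z ⊗ U t r) tr ∘ hassocV V W Z E1 E2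
  = (idm W ⊠ b V s Z r ⊠ idm (U t rs)) ∘ hassocV W V Z E1' E3'
    ∘ (b V s W t ⊠ idm Z ⊠ idm (U st r)).

Definition bS b V s W t T :
    hom (V ⊗ (W ⊗ (U s t ⊗ T))) (W ⊗ (V ⊗ (U t s ⊗ T))) :=
  @strict _ C (Ten (Ten (At V) (At W)) (At (U s t)))
    (Ten (Ten (At W) (At V)) (At (U t s))) (b V s W t) T.

Definition zbS s t Z T : hom (Z ⊗ (U s t ⊗ T)) (U s t ⊗ (Z ⊗ T)) :=
  @strict _ C (Ten (At Z) (At (U s t))) (Ten (At (U s t)) (At Z))
    (fwd (zbr (U s t) Z)) T.

Definition zbVS s t Z T : hom (U s t ⊗ (Z ⊗ T)) (Z ⊗ (U s t ⊗ T)) :=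
  @strict _ C (Ten (At (U s t)) (At Z)) (Ten (At Z) (At (U s t)))
    (bwd (zbr (U s t) Z)) T.

Definition omS s t r st tr (E1 : s * t = st) (E2 : t * r = tr) T :
    hom (U t r ⊗ (U s tr ⊗ T)) (U s t ⊗ (U st r ⊗ T)) :=
  @strict _ C (Ten (At (U t r)) (At (U s tr))) (Ten (At (U s t)) (At (U st r)))
    (omg E1 E2) T.

Definition omVS s t r st tr (E1 : s * t = st) (E2 : t * r = tr) T :
    hom (U s t ⊗ (U st r ⊗ T)) (U t r ⊗ (U s tr ⊗ T)) :=
  @strict _ C (Ten (At (U s t)) (At (U st r))) (Ten (At (U t r)) (At (U s tr)))
    (omgV E1 E2) T.

(** The passage between named products and the casts [ucast] of (B3); [omgV_cast] does the same for
    (B4). *)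
Lemma omg_cast s t r st tr (E1 : s * t = st) (E2 : t * r = tr) :
  omg E1 E2 = (U s t ◁ ucast U E1 erefl) ∘ fwd (om A s t r)
    ∘ (U t r ◁ ucast U erefl (esym E2)).
Proof.
by case: _ / E1; case: _ / E2; rewrite /ucast !eqhom_refl !ten_id id_comp comp_id.
Qed.

Lemma omgV_cast s t r st tr (E1 : s * t = st) (E2 : t * r = tr) :
  omgV E1 E2 = (U t r ◁ ucast U erefl E2) ∘ bwd (om A s t r)
    ∘ (U s t ◁ ucast U (esym E1) erefl).
Proof.
by case: _ / E1; case: _ / E2; rewrite /ucast !eqhom_refl !ten_id id_comp comp_id.
Qed.

Lemma zbVS_K s t Z T : zbVS s t Z T ∘ zbS s t Z T = idm _.
Proof.
exact: (strict_bwd (a := Ten (At Z) (At (U s t))) (b := Ten (At (U s t)) (At Z)) T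
  (fwdK _)).
Qed.

Lemma zbS_K s t Z T : zbS s t Z T ∘ zbVS s t Z T = idm _.
Proof.
exact: (strict_bwd (a := Ten (At (U s t)) (At Z)) (b := Ten (At Z) (At (U s t))) T
  (bwdK _)).
Qed.

Lemma zbS_nat s t Z T T' (h : hom T T') :
  zbS s t Z T' ∘ (Z ◁ (U s t ◁ h)) = (U s t ◁ (Z ◁ h)) ∘ zbS s t Z T.
Proof. exact: (@strict_nat _ C (Ten (At Z) (At (U s t))) (Ten (At (U s t)) (At Z))). Qed.

Lemma zbSE s t Z T : strict (a := Ten (At Z) (At (U s t)))
  (b := Ten (At (U s t)) (At Z)) (fwd (zbr (U s t) Z)) T = zbS s t Z T.
Proof. by []. Qed.
Lemma zbVSE s t Z T : strict (a := Ten (At (U s t)) (At Z))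
  (b := Ten (At Z) (At (U s t))) (bwd (zbr (U s t) Z)) T = zbVS s t Z T.
Proof. by []. Qed.
Lemma omSE s t r st tr (E1 : s * t = st) (E2 : t * r = tr) T :
  strict (a := Ten (At (U t r)) (At (U s tr))) (b := Ten (At (U s t)) (At (U st r)))
    (omg E1 E2) T = omS E1 E2 T.
Proof. by []. Qed.
Lemma omVSE s t r st tr (E1 : s * t = st) (E2 : t * r = tr) T :
  strict (a := Ten (At (U s t)) (At (U st r))) (b := Ten (At (U t r)) (At (U s tr)))
    (omgV E1 E2) T = omVS E1 E2 T.
Proof. by []. Qed.

(** * Consequences of (B1)-(B4) for the twisted braiding *)

Section FromAction.
Variable B : actionBraiding mulGC c A.

(** This is (B1) without inverses: naturality of the half-braiding carries [thb st] past it, where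
    it cancels its inverse. *)
Lemma brr_zbr s t st Z : s * t = st ->
  brr c (thb B st) (U s t) Z ∘ fwd (zbr (U s t) Z)
  = (fwd (thb B s Z) ∘ fwd (thb B t Z)) ▷ U s t.
Proof.
move=> <-; rewrite /brr comp_assoc -zbr_nat -comp_assoc (actionB1 B) ten_comp comp_id.
by rewrite !comp_assoc -(comp_assoc _ _ (fwd _)) -na_nat -comp_assoc fwdK id_comp.
Qed.

Lemma zbr_brl s t st Z : s * t = st ->
  bwd (zbr (U s t) Z) ∘ brl c (th B st) Z (U s t)
  = (fwd (th B s Z) ∘ fwd (th B t Z)) ▷ U s t.
Proof.
move=> <-; rewrite /brl -comp_assoc (actionB2 B) ten_comp comp_id.
by rewrite !comp_assoc -(comp_assoc _ _ (fwd _)) -na_nat -comp_assoc fwdK id_comp.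
Qed.

Lemma omg_tw s t r st tr rs
    (E1 : s * t = st) (E2 : t * r = tr) (E2' : r * t = tr)
    (E3 : r * s = rs) (E3' : s * r = rs) :
  omg E3 E1 ∘ (fwd (th B r (U s t)) ⊠ fwd (tw B st r)) ∘ omg E1 E2
  = (fwd (tw B s r) ▷ U rs t) ∘ omg E3' E2' ∘ (fwd (tw B t r) ▷ U s tr).
Proof.
case: _ / E1 {E2'} (E2') => E2'; case: _ / E2 E2' => E2'; case: _ / E3 E3' => E3'.
rewrite /= actionB3 omg_cast -!comp_assoc ten_comp comp_id id_comp.
rewrite (comp_assoc _ _ (fwd (tw B t r) ▷ _)) ten_comp comp_id id_comp.
by congr (_ ⊠ _ ∘ _ ∘ (_ ⊠ _)); apply: eqhom_irr.
Qed.

Lemma omgV_tw s t r st tr rs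
    (E1 : s * t = st) (E1' : t * s = st) (E2 : t * r = tr)
    (E3 : r * s = rs) (E3' : s * r = rs) :
  omgV E2 E3 ∘ (fwd (thb B s (U t r)) ⊠ fwd (tw B s tr)) ∘ omgV E1 E2
  = (fwd (tw B s r) ▷ U t rs) ∘ omgV E1' E3' ∘ (fwd (tw B s t) ▷ U st r).
Proof.
case: _ / E1 E1' => E1'; case: _ / E2; case: _ / E3 E3' => E3'.
rewrite /= actionB4 omgV_cast -!comp_assoc ten_comp comp_id id_comp.
rewrite (comp_assoc _ _ (fwd (tw B s t) ▷ _)) ten_comp comp_id id_comp.
by congr (_ ⊠ _ ∘ _ ∘ (_ ⊠ _)); apply: eqhom_irr.
Qed.

Definition brt s t V W : hom (V ⊗ W) (W ⊗ V) :=
  fwd (br c V W) ∘ (fwd (th B t V) ⊠ fwd (thb B s W)).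

Definition prod_family : hfamily := fun V s W t => brt s t V W ⊠ fwd (tw B s t).

(** The factor [brl] obeys the first hexagon, and the factor [brr] of [brtEr] the second. The twist
    left over is treated by (B1), respectively (B2). *)
Lemma brtEl s t V W : brt s t V W = brl c (th B t) V W ∘ (V ◁ fwd (thb B s W)).
Proof. by rewrite /brt /brl ten_split comp_assoc. Qed.

Lemma brtEr s t V W : brt s t V W = brr c (thb B s) V W ∘ (fwd (th B t V) ▷ W).
Proof. by rewrite /brt /brr comp_assoc ten_comp id_comp comp_id. Qed.

Definition brtS s t V W T : hom (V ⊗ (W ⊗ T)) (W ⊗ (V ⊗ T)) :=
  @strict _ C (Ten (At V) (At W)) (Ten (At W) (At V)) (brt s t V W) T.

Lemma brt_zbr s t r st Z : s * t = st ->
  brt st r (U s t) Z ∘ fwd (zbr (U s t) Z)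
  = (Z ◁ fwd (th B r (U s t))) ∘ ((fwd (thb B s Z) ∘ fwd (thb B t Z)) ▷ U s t).
Proof.
move=> E; rewrite -(brr_zbr Z E) /brr -!comp_assoc -br_nat; congr (_ ∘ _).
by rewrite /brt comp_assoc ten_comp id_comp comp_id.
Qed.

Lemma zbr_brt s t r st Z : s * t = st ->
  bwd (zbr (U s t) Z) ∘ brt r st Z (U s t)
  = (Z ◁ fwd (thb B r (U s t))) ∘ ((fwd (th B s Z) ∘ fwd (th B t Z)) ▷ U s t).
Proof.
move=> E; rewrite -interchange -(zbr_brl Z E) comp_assoc; congr (_ ∘ _).
by rewrite brtEl.
Qed.

(** By (B1), the half-braiding followed by the braiding of $U_{s,t}$ with Z becomes [thb s] and
    [thb t] on Z and [th r] on $U_{s,t}$. Then [thb t] joins the braiding of W with Z, while [thb s]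
    slides through it to join that of V with Z. *)
Lemma brtS_zbS s t r st V W Z T : s * t = st ->
  strict (a := Ten (Ten (Ten (At V) (At W)) (At (U s t))) (At Z))
    (b := Ten (At Z) (Ten (Ten (At V) (At W)) (At (U s t))))
    (brt st r (V ⊗ W ⊗ U s t) Z) T ∘ (V ◁ (W ◁ zbS s t Z T))
  = brtS s r V Z (W ⊗ (U s t ⊗ T)) ∘ (V ◁ brtS t r W Z (U s t ⊗ T))
    ∘ (V ◁ (W ◁ (Z ◁ (fwd (th B r (U s t)) ▷ T)))).
Proof.
move=> E.
have H := brtEl st r (V ⊗ W ⊗ U s t) Z; strict_hyp C H T.
rewrite {}HS (brlS_ten c _ (Ten (At V) (At W)) (At (U s t)) (At Z)) /=.
rewrite (brlS_ten c _ (At V) (At W) (At Z)) /=.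
have K := brt_zbr r Z E; strict_hyp C K T.
have L := brtEl st r (U s t) Z; strict_hyp C L T.
have M := brtEl s r V Z; strict_hyp C M (W ⊗ (U s t ⊗ T)).
have N := brtEl t r W Z; strict_hyp C N (U s t ⊗ T).
rewrite /brtS MS NS; move: KS; rewrite LS.
rewrite !(ten_id, id_comp, comp_id, strict_At) -/(zbS _ _ _ _) => KS.
rewrite !comp_assoc -!whisker_comp !comp_assoc in KS *.
rewrite KS -(comp_assoc (_ ▷ (W ⊗ _))) brlS_natr !comp_assoc -!whisker_comp.
by rewrite -(comp_assoc (Z ◁ _)) -!interchange comp_assoc -interchange.
Qed.

(** The mirror image: (B2) replaces (B1), and [th] and [thb] exchange their roles. *)
Lemma zbVS_brtS s t r st V W Z T : s * t = st ->
  (W ◁ (Z ◁ zbVS s t V T)) ∘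
  strict (a := Ten (At V) (Ten (Ten (At W) (At Z)) (At (U s t))))
    (b := Ten (Ten (Ten (At W) (At Z)) (At (U s t))) (At V))
    (brt r st V (W ⊗ Z ⊗ U s t)) T
  = (W ◁ (Z ◁ (V ◁ (fwd (thb B r (U s t)) ▷ T))))
    ∘ (W ◁ brtS r t V Z (U s t ⊗ T)) ∘ brtS r s V W (Z ⊗ (U s t ⊗ T)).
Proof.
move=> E.
have H := brtEr r st V (W ⊗ Z ⊗ U s t); strict_hyp C H T.
rewrite {}HS (brrS_ten c _ (At V) (Ten (At W) (At Z)) (At (U s t))) /=.
rewrite (brrS_ten c _ (At V) (At W) (At Z)) /=.
have K := zbr_brt r V E; strict_hyp C K T.
have L := brtEr r st V (U s t); strict_hyp C L T.
have M := brtEr r s V W; strict_hyp C M (Z ⊗ (U s t ⊗ T)).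
have N := brtEr r t V Z; strict_hyp C N (U s t ⊗ T).
rewrite /brtS MS NS; move: KS; rewrite LS.
rewrite !(ten_id, id_comp, comp_id, strict_At, nfm_id) -/(zbVS _ _ _ _) => KS.
rewrite -!comp_assoc in KS; rewrite !comp_assoc -!brrS_natl.
rewrite -!comp_assoc -!whisker_comp; congr (_ ∘ _); congr (_ ◁ _).
rewrite !comp_assoc -!brrS_natl -!comp_assoc -!whisker_comp KS !comp_assoc.
congr (_ ◁ (_ ∘ _) ∘ _).
by rewrite -!comp_whisker na_nat.
Qed.

Lemma brtSE s t V W T : strict (a := Ten (At V) (At W)) (b := Ten (At W) (At V))
  (brt s t V W) T = brtS s t V W T.
Proof. by []. Qed.

Lemma brtS_nat s t V W T T' (h : hom T T') :
  brtS s t V W T' ∘ (V ◁ (W ◁ h)) = (W ◁ (V ◁ h)) ∘ brtS s t V W T.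
Proof. exact: (@strict_nat _ C (Ten (At V) (At W)) (Ten (At W) (At V))). Qed.

Lemma zbS_tw s t Z T :
  zbS t s Z T ∘ (Z ◁ (fwd (tw B s t) ▷ T)) = (fwd (tw B s t) ▷ (Z ⊗ T)) ∘ zbS s t Z T.
Proof.
have H := tw_central B s t Z; rewrite /hb in H; strict_hyp C H T.
by move: HS; rewrite !strict_At !(ten_id, id_comp, comp_id).
Qed.

Lemma zbVS_tw s t Z T :
  zbVS t s Z T ∘ (fwd (tw B s t) ▷ (Z ⊗ T)) = (Z ◁ (fwd (tw B s t) ▷ T)) ∘ zbVS s t Z T.
Proof.
rewrite -[LHS]comp_id -(zbS_K s t) -comp_assoc (comp_assoc (zbVS _ _ _ _)) -zbS_tw.
by rewrite -(comp_assoc (zbVS _ _ _ _)) zbVS_K id_comp.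
Qed.

End FromAction.
End Homogeneous.

(** * The hexagons for the family of a braiding of the action *)

Section ActionBraidingHexagons.
Variables (k : fieldType) (G : groupType) (C : tensorCat k).
Hypothesis mulGC : forall s t : G, (s * t = t * s)%g.
Variables (c : braiding C) (A : centralOuterAction G C).
Local Open Scope group_scope.
Local Notation U := (cU A).
Implicit Types (V W X Y Z T : ob C) (s t r : G).
Variable B : actionBraiding mulGC c A.

(** Naturality separates the braidings of V and W with Z from the maps between the objects U, on
    which (B3) then applies. *)
Lemma prod_hexagon1 : hhexagon1 (prod_family B).
Proof.
move=> V W Z s t r st tr rs E1 E2 E2' E3 E3'.
have BS := omg_tw B E1 E2 E2' E3 E3'.
rewrite /hassoc /prod_family.
strict_goal C; strict_hyp C BS T; move: BSS => {BS}.
rewrite ?(ten_id, comp_id, id_comp, strict_At, zbSE, omSE, brtSE) => BS.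
rewrite comp_assoc in BS.
rewrite !comp_assoc -!whisker_comp -(comp_assoc (U s t ◁ _)) -zbS_nat comp_assoc.
(* Here (B1) absorbs the half-braiding with Z. *)
rewrite !whisker_comp (comp_eq _ (brtS_zbS B _ _ _ _ _ E1)).
rewrite !comp_assoc -!whisker_comp.
rewrite -(comp_assoc (Z ◁ (V ◁ (W ◁ _)))) -brtS_nat comp_assoc.
rewrite -(comp_assoc (Z ◁ (V ◁ zbS _ _ _ _ _))) -brtS_nat comp_assoc -!whisker_comp.
congr (_ ∘ (_ ◁ _)).
rewrite -(comp_assoc (Z ◁ (W ◁ _)) (brtS _ _ _ _ _ _)) -brtS_nat.
rewrite comp_assoc -!whisker_comp; rewrite !comp_assoc in BS *.
rewrite BS !whisker_comp -(comp_assoc (brtS _ _ _ _ _ _)) brtS_nat !comp_assoc.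
(* After (B3), the two sides differ by the order of $t_{s,r}$ and the half-braiding with W;
   centrality exchanges them. *)
rewrite -(comp_assoc (Z ◁ zbS _ _ _ _ _)) -whisker_comp zbS_tw whisker_comp comp_assoc.
by rewrite -[in RHS](comp_assoc (Z ◁ (W ◁ _))) -brtS_nat comp_assoc.
Qed.

(** The same separation, with (B2) absorbing the inverse half-braiding and (B4) acting on the
    objects U. *)
Lemma prod_hexagon2 : hhexagon2 (prod_family B).
Proof.
move=> V W Z s t r st tr rs E1 E1' E2 E3 E3'.
have BS := omgV_tw B E1 E1' E2 E3 E3'.
rewrite /hassocV /prod_family.
strict_goal C; strict_hyp C BS T; move: BSS => {BS}.
rewrite ?(ten_id, comp_id, id_comp, strict_At, zbVSE, omVSE, brtSE) => BS.
rewrite comp_assoc in BS.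
rewrite !comp_assoc.
rewrite (comp_eq _ (zbVS_brtS B _ _ _ _ _ E2)).
rewrite -(comp_assoc (V ◁ (W ◁ (Z ◁ (U t r ◁ _))))).
rewrite -(whisker_comp V (W ◁ (Z ◁ _)) (W ◁ (Z ◁ _))).
rewrite -(whisker_comp W (Z ◁ _) (Z ◁ _)) -(whisker_comp Z).
rewrite !comp_assoc -(comp_assoc (brtS _ _ _ V W _)) brtS_nat.
rewrite comp_assoc -(comp_assoc (W ◁ brtS _ _ _ _ _ _)) -whisker_comp brtS_nat.
rewrite -!comp_assoc -!whisker_comp -[in X in X ∘ _ ∘ _]comp_assoc.
rewrite -!whisker_comp (comp_assoc (omVS _ _ _ _)); rewrite !comp_assoc in BS *.
(* The maps between the objects U are now adjacent, and (B4) applies. *)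
rewrite BS -brtS_nat !whisker_comp !comp_assoc; do 3 congr (_ ∘ _).
rewrite -!(comp_assoc (W ◁ _)) -!brtS_nat !comp_assoc -!whisker_comp.
by rewrite zbVS_tw.
Qed.

Lemma prod_natural : hnatural (prod_family B).
Proof.
move=> V V' W W' s t f g; rewrite /prod_family !ten_comp id_comp comp_id; congr (_ ⊠ _).
rewrite /brt comp_assoc ten_comp !na_nat -ten_comp -!comp_assoc; congr (_ ∘ _).
exact: br_nat.
Qed.

Lemma prod_unit V W : prod_family B V 1 W 1 = fwd (br c V W) ▷ U 1 1.
Proof.
rewrite /prod_family /brt th1 thb1 ten_id comp_id; congr (_ ⊠ _).
by have [E ->] := tw1r B 1; rewrite eqhom_refl.
Qed.

Definition prod_familyV V s W t : hom (W ⊗ V ⊗ U t s) (V ⊗ W ⊗ U s t) :=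
  ((bwd (th B t V) ⊠ bwd (thb B s W)) ∘ bwd (br c V W)) ⊠ bwd (tw B s t).

Lemma prod_familyK V s W t : prod_familyV V s W t ∘ prod_family B V s W t = idm _.
Proof.
rewrite /prod_familyV /prod_family /brt ten_comp fwdK comp_assoc.
rewrite -(comp_assoc (bwd (br _ _ _))) fwdK id_comp ten_comp !fwdK.
by rewrite !ten_id.
Qed.

Lemma prod_familyVK V s W t : prod_family B V s W t ∘ prod_familyV V s W t = idm _.
Proof.
rewrite /prod_familyV /prod_family /brt ten_comp bwdK comp_assoc.
rewrite -(comp_assoc (_ ⊠ _) (_ ⊠ _)) ten_comp !bwdK ten_id id_comp bwdK.
by rewrite !ten_id.
Qed.

End ActionBraidingHexagons.

(** * Extension from homogeneous objects to direct sums *)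

Section Matrices.
Variables (k : fieldType) (G : groupType) (C : tensorCat k).

Lemma comp_suml (X Y Z : ob C) (f : hom X Y) (I : finType) (F : I -> hom Y Z) :
  (\sum_i F i) ∘ f = \sum_i (F i ∘ f).
Proof.
apply: (big_morph (fun g => g ∘ f)) => [g g'|]; last exact: comp0m.
by have := comp_linearl (tc_linear C) f 1 g g'; rewrite !scale1r.
Qed.

Lemma comp_sumr (X Y Z : ob C) (g : hom Y Z) (I : finType) (F : I -> hom X Y) :
  g ∘ (\sum_i F i) = \sum_i (g ∘ F i).
Proof.
apply: (big_morph (fun f => g ∘ f)) => [f f'|]; last exact: compm0.
by have := comp_linearr (tc_linear C) g 1 f f'; rewrite !scale1r.
Qed.

Lemma ten0m (X X' Y Y' : ob C) (g : hom Y Y') : (0 : hom X X') ⊠ g = 0.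
Proof.
exact: (linear_fun0 (f := fun f => f ⊠ g) (tenm_linearl (tc_bifunctor C) g)).
Qed.

Lemma delta_hom_eq (T : eqType) (F : T -> ob C) x y (E : x = y) :
  delta_hom F x y = eqhom (congr1 F E).
Proof. by rewrite /delta_hom; case: eqP => // E'; apply: eqhom_irr. Qed.

Lemma delta_hom_id (T : eqType) (F : T -> ob C) x : delta_hom F x x = idm (F x).
Proof. by rewrite (delta_hom_eq F erefl). Qed.

Lemma delta_hom_neq (T : eqType) (F : T -> ob C) x y : x <> y -> delta_hom F x y = 0.
Proof. by rewrite /delta_hom; case: eqP. Qed.

Implicit Types X Y Z : sumOb G C.

Lemma sum_comp_reindex X Y Z (phi : idx X -> idx Y)
    (f : forall i, hom (cmp i) (cmp (phi i))) dgf (N : sumHom Y Z) i l :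
  sum_comp N (reindex_mor f dgf) i l = N (phi i) l ∘ f i.
Proof.
rewrite /= (bigD1 (phi i)) //= delta_hom_id id_comp big1 ?addr0 // => j nj.
by rewrite delta_hom_neq ?comp0m ?compm0 // => e; rewrite e eqxx in nj.
Qed.

(** Injectivity of [psi] leaves a single nonzero term in the matrix product. *)
Lemma sum_comp_reindexl X Y Z (psi : idx Y -> idx Z)
    (g : forall j, hom (cmp j) (cmp (psi j))) dgg (M : sumHom X Y) i j :
  injective psi -> sum_comp (reindex_mor g dgg) M i (psi j) = g j ∘ M i j.
Proof.
move=> inj_psi; rewrite /= (bigD1 j) //= delta_hom_id id_comp big1 ?addr0 // => j' nj.
rewrite delta_hom_neq ?comp0m // => /inj_psi e; by rewrite e eqxx in nj.
Qed.

Lemma reindex_morE X Y (phi : idx X -> idx Y)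
    (f : forall i, hom (cmp i) (cmp (phi i))) dgf i :
  reindex_mor f dgf i (phi i) = f i.
Proof. by rewrite /= delta_hom_id id_comp. Qed.

Lemma reindex_mor_eq X Y (phi : idx X -> idx Y)
    (f f' : forall i, hom (cmp i) (cmp (phi i))) dgf dgf' :
  (forall i, f i = f' i) -> reindex_mor f dgf = reindex_mor f' dgf'.
Proof. by move=> e; apply: sumHom_eq => i j /=; rewrite e. Qed.

Lemma reindex_mor_comp X Y Z (phi : idx X -> idx Y) (psi : idx Y -> idx Z)
    (f : forall i, hom (cmp i) (cmp (phi i))) dgf
    (g : forall j, hom (cmp j) (cmp (psi j))) dgg :
  sum_comp (reindex_mor g dgg) (reindex_mor f dgf)
  = @reindex_mor k G C X Z (fun i => psi (phi i)) (fun i => g (phi i) ∘ f i)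
      (fun i => etrans (dgg (phi i)) (dgf i)).
Proof.
by apply: sumHom_eq => i l; rewrite sum_comp_reindex /= comp_assoc.
Qed.

Lemma sum_idmE X :
  sum_idm X = @reindex_mor k G C X X (fun i => i) (fun i => idm (cmp i)) (fun=> erefl).
Proof. by apply: sumHom_eq => i j /=; rewrite comp_id. Qed.

Lemma sum_comp_idl X Y (M : sumHom X Y) : sum_comp (sum_idm Y) M = M.
Proof.
apply: sumHom_eq => i j; rewrite sum_idmE.
by rewrite (sum_comp_reindexl (psi := fun j => j)) ?id_comp.
Qed.

Lemma sum_comp_idr X Y (M : sumHom X Y) : sum_comp M (sum_idm X) = M.
Proof. by apply: sumHom_eq => i j; rewrite sum_idmE sum_comp_reindex comp_id. Qed.

Lemma sum_compA X Y Z (T : sumOb G C) (P : sumHom Z T) (N : sumHom Y Z) (M : sumHom X Y) :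
  sum_comp (sum_comp P N) M = sum_comp P (sum_comp N M).
Proof.
apply: sumHom_eq => i l /=; under eq_bigr do rewrite comp_suml.
rewrite exchange_big /=; apply: eq_bigr => j _; rewrite comp_sumr.
by apply: eq_bigr => j' _; rewrite comp_assoc.
Qed.

End Matrices.

Section IsoEq.

(** A [monData] carries no laws, so the category laws are hypotheses; C and the crossed product each
    supply their own. *)
Lemma iso_eq (k : fieldType) (M : monData k) (X Y : ob M) (f g : iso X Y) :
  (forall Z T (x : @hom k M Z T), idm T ∘ x = x) ->
  (forall Z T (x : @hom k M Z T), x ∘ idm Z = x) ->
  (forall Z T P Q (z : @hom k M P Q) (y : hom T P) (x : hom Z T), z ∘ y ∘ x = z ∘ (y ∘ x)) ->
  fwd f = fwd g -> f = g.
Proof.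
move=> idl idr cA; case: f g => [f f' ff' f'f] [g g' gg' g'g] /= e; subst g.
have e : f' = g' by rewrite -[LHS]idr -g'g -cA ff' idl.
by subst g'; rewrite (Prop_irrelevance ff' gg') (Prop_irrelevance f'f g'g).
Qed.

End IsoEq.

(** * Braidings of the crossed product and families on homogeneous objects *)

Section CrossedProduct.
Variables (k : fieldType) (G : groupType) (C : tensorCat k).
Hypothesis mulGC : forall s t : G, (s * t = t * s)%g.
Variable A : centralOuterAction G C.
Local Open Scope group_scope.
Local Notation U := (cU A).
Implicit Types (X Y Z : sumOb G C) (h : hfamily A).

(** Identities, associators and [sum_family] are all reindexing matrices. Since these are closed
    under composition and tensor product, each hexagon reduces to one entry per index. *)
Lemma cr_tenm_reindex X X' Y Y' (phi : idx X -> idx X') (psi : idx Y -> idx Y')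
    (f : forall i, hom (cmp i) (cmp (phi i))) dgf
    (g : forall j, hom (cmp j) (cmp (psi j))) dgg :
  cr_tenm A (reindex_mor f dgf) (reindex_mor g dgg)
  = @reindex_mor k G C (cr_ten A X Y) (cr_ten A X' Y')
      (fun p => (phi p.1, psi p.2))
      (fun p => f p.1 ⊠ g p.2 ⊠ ucast U (esym (dgf p.1)) (esym (dgg p.2)))
      (fun p => f_equal2 (fun a b : G => a * b) (dgf p.1) (dgg p.2)).
Proof.
apply: sumHom_eq => -[i j] [i' j'] /=.
have [e|ne] := phi i =P i'; last first.
  by rewrite !(delta_hom_neq _ ne) comp0m !ten0m delta_hom_neq ?comp0m // => -[].
have [e'|ne] := psi j =P j'; last first.
  by rewrite !(delta_hom_neq _ ne) comp0m tenm0 ten0m delta_hom_neq ?comp0m // => -[].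
subst i' j'; rewrite !delta_hom_id !id_comp; congr (_ ⊠ _).
have E : (dg i, dg j) = (dg (phi i), dg (psi j)) by rewrite dgf dgg.
by rewrite (delta_hom_eq _ E); apply: eqhom_irr.
Qed.

Definition sum_family h X Y : sumHom (cr_ten A X Y) (cr_ten A Y X) :=
  @reindex_mor k G C (cr_ten A X Y) (cr_ten A Y X) (fun p => (p.2, p.1))
    (fun p => h (cmp p.1) (dg p.1) (cmp p.2) (dg p.2))
    (fun p => mulGC (dg p.2) (dg p.1)).

Lemma hnatural_cast h V V' W W' s s' t t' (f : hom V V') (g : hom W W')
    (E : s = s') (E' : t = t') : hnatural h ->
  h V' s' W' t' ∘ (f ⊠ g ⊠ ucast U E E') = (g ⊠ f ⊠ ucast U E' E) ∘ h V s W t.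
Proof.
by move=> hn; case: s' / E; case: t' / E'; rewrite /ucast !eqhom_refl hn.
Qed.

Lemma sum_family_nat h X X' Y Y' (M : sumHom X X') (N : sumHom Y Y') : hnatural h ->
  sum_comp (sum_family h X' Y') (cr_tenm A M N)
  = sum_comp (cr_tenm A N M) (sum_family h X Y).
Proof.
move=> hn; apply: sumHom_eq => -[i j] [j' i'].
rewrite sum_comp_reindex.
rewrite (sum_comp_reindexl (X := cr_ten A X Y) (Y := cr_ten A X' Y') (Z := cr_ten A Y' X')
  (psi := fun p => (p.2, p.1)) _ _ _ _ (i', j')) /=; last by move=> [? ?] [? ?] [-> ->].
(* If a degree changes, an entry of [M] or [N] is 0 and both sides vanish; otherwise the deltas are
   casts. *)
have [e|/entP->] := dg i =P dg i'; last by rewrite !(ten0m, tenm0) comp0m compm0.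
have [e'|/entP->] := dg j =P dg j'; last by rewrite !(ten0m, tenm0) comp0m compm0.
have E : (dg i, dg j) = (dg i', dg j') by rewrite e e'.
have E' : (dg j, dg i) = (dg j', dg i') by rewrite e e'.
rewrite (delta_hom_eq _ E) (delta_hom_eq _ E').
have -> : eqhom (congr1 (fun d : G * G => zob (U d.1 d.2)) E) = ucast U e e'.
  exact: eqhom_irr.
have -> : eqhom (congr1 (fun d : G * G => zob (U d.1 d.2)) E') = ucast U e' e.
  exact: eqhom_irr.
exact: hnatural_cast.
Qed.

Lemma reindex_mor_inj X Y (phi : idx X -> idx Y)
    (f f' : forall i, hom (cmp i) (cmp (phi i))) dgf dgf' :
  reindex_mor f dgf = reindex_mor f' dgf' -> forall i, f i = f' i.
Proof. by move=> e i; rewrite -(reindex_morE f dgf) e reindex_morE. Qed.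

Lemma hexagon1_cast h (V W Z : ob C) s t r tr rs (E2' : r * t = tr) (E3' : s * r = rs) :
  (h V s Z r ⊠ idm W ⊠ idm (U rs t)) ∘ hassoc A V Z W E3' E2'
    ∘ (idm V ⊠ h W t Z r ⊠ idm (U s tr))
  = (h V s Z r ⊠ idm W ⊠ ucast U E3' erefl) ∘ hmg_assoc A V Z W s r t
    ∘ (idm V ⊠ h W t Z r ⊠ ucast U erefl (esym E2')).
Proof. by case: _ / E2'; case: _ / E3'; rewrite /ucast !eqhom_refl. Qed.

Lemma hexagon2_cast h (V W Z : ob C) s t r st rs (E1' : t * s = st) (E3' : s * r = rs) :
  (idm W ⊠ h V s Z r ⊠ idm (U t rs)) ∘ hassocV A W V Z E1' E3'
    ∘ (h V s W t ⊠ idm Z ⊠ idm (U st r))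
  = (idm W ⊠ h V s Z r ⊠ ucast U erefl E3') ∘ hmg_assocV A W V Z t s r
    ∘ (h V s W t ⊠ idm Z ⊠ ucast U (esym E1') erefl).
Proof. by case: _ / E1'; case: _ / E3'; rewrite /ucast !eqhom_refl. Qed.

Lemma sum_hexagon1 h X Y Z : hhexagon1 h ->
  sum_comp (sum_comp (cr_assoc A Z X Y) (sum_family h (cr_ten A X Y) Z)) (cr_assoc A X Y Z)
  = sum_comp (sum_comp (cr_tenm A (sum_family h X Z) (sum_idm Y)) (cr_assoc A X Z Y))
      (cr_tenm A (sum_idm X) (sum_family h Y Z)).
Proof.
move=> h1; rewrite !sum_idmE /sum_family !cr_tenm_reindex /cr_assoc.
rewrite !reindex_mor_comp.
apply: reindex_mor_eq => -[i [j l]] /=.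
rewrite -hexagon1_cast; exact: (h1 _ _ _ _ _ _ _ _ _ erefl erefl _ erefl).
Qed.

Lemma sum_hexagon2 h X Y Z : hhexagon2 h ->
  sum_comp (sum_comp (cr_assocV A Y Z X) (sum_family h X (cr_ten A Y Z))) (cr_assocV A X Y Z)
  = sum_comp (sum_comp (cr_tenm A (sum_idm Y) (sum_family h X Z)) (cr_assocV A Y X Z))
      (cr_tenm A (sum_family h X Y) (sum_idm Z)).
Proof.
move=> h2; rewrite !sum_idmE /sum_family !cr_tenm_reindex /cr_assocV.
rewrite !reindex_mor_comp; apply: reindex_mor_eq => -[[i j] l] /=.
rewrite -hexagon2_cast; exact: (h2 _ _ _ _ _ _ _ _ _ erefl _ erefl erefl).
Qed.

(** On homogeneous objects every matrix has a single entry, which is the hexagon of [h] up to casts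
    along equalities in G. *)
Lemma hhexagon1_of h :
 (forall X Y Z,
  sum_comp (sum_comp (cr_assoc A Z X Y) (sum_family h (cr_ten A X Y) Z)) (cr_assoc A X Y Z)
  = sum_comp (sum_comp (cr_tenm A (sum_family h X Z) (sum_idm Y)) (cr_assoc A X Z Y))
      (cr_tenm A (sum_idm X) (sum_family h Y Z))) -> hhexagon1 h.
Proof.
move=> sh V W Z s t r st tr rs E1 E2 E2' E3 E3'.
have := sh (hmg V s) (hmg W t) (hmg Z r).
rewrite !sum_idmE /sum_family !cr_tenm_reindex /cr_assoc.
rewrite !reindex_mor_comp => /reindex_mor_inj/(_ (tt,(tt,tt))) /=.
rewrite hexagon1_cast.
case: _ / E1; case: _ / E2 E2' => E2'; case: _ / E3 E3' => E3' /=.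
by rewrite (Prop_irrelevance E2' (mulGC r t)) (Prop_irrelevance E3' (esym (mulGC r s))).
Qed.

Lemma hhexagon2_of h :
 (forall X Y Z,
  sum_comp (sum_comp (cr_assocV A Y Z X) (sum_family h X (cr_ten A Y Z))) (cr_assocV A X Y Z)
  = sum_comp (sum_comp (cr_tenm A (sum_idm Y) (sum_family h X Z)) (cr_assocV A Y X Z))
      (cr_tenm A (sum_family h X Y) (sum_idm Z))) -> hhexagon2 h.
Proof.
move=> sh V W Z s t r st tr rs E1 E1' E2 E3 E3'.
have := sh (hmg V s) (hmg W t) (hmg Z r).
rewrite !sum_idmE /sum_family !cr_tenm_reindex /cr_assocV.
rewrite !reindex_mor_comp => /reindex_mor_inj/(_ ((tt,tt),tt)) /=.
rewrite hexagon2_cast.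
case: _ / E1 E1' => E1'; case: _ / E2; case: _ / E3 E3' => E3' /=.
by rewrite (Prop_irrelevance E1' (mulGC t s)) (Prop_irrelevance E3' (esym (mulGC r s))).
Qed.

Definition family_of (b : braiding (crossed A)) : hfamily A := fun V s W t =>
  ent (fwd (br b (hmg V s : ob (crossed A)) (hmg W t : ob (crossed A)))) (tt, tt) (tt, tt).

Definition familyV_of (b : braiding (crossed A)) V s W t :
    hom (W ⊗ V ⊗ U t s) (V ⊗ W ⊗ U s t) :=
  ent (bwd (br b (hmg V s : ob (crossed A)) (hmg W t : ob (crossed A)))) (tt, tt) (tt, tt).

Lemma sum_unit2 (V : zmodType) (F : unit * unit -> V) : \sum_p F p = F (tt, tt).
Proof. by rewrite (big_pred1 (tt, tt)) // => -[[] []]. Qed.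

Lemma family_ofK b V s W t : familyV_of b V s W t ∘ family_of b V s W t = idm _.
Proof.
pose XY := cr_ten A (hmg V s) (hmg W t).
have /(congr1 (fun f : sumHom XY XY => f (tt, tt) (tt, tt))) :=
  fwdK (br b (hmg V s : ob (crossed A)) (hmg W t : ob (crossed A))).
by rewrite /= sum_unit2 delta_hom_id.
Qed.

Lemma family_ofVK b V s W t : family_of b V s W t ∘ familyV_of b V s W t = idm _.
Proof.
pose YX := cr_ten A (hmg W t) (hmg V s).
have /(congr1 (fun f : sumHom YX YX => f (tt, tt) (tt, tt))) :=
  bwdK (br b (hmg V s : ob (crossed A)) (hmg W t : ob (crossed A))).
by rewrite /= sum_unit2 delta_hom_id.
Qed.

Definition summand X (i : idx X) : sumHom (hmg (cmp i) (dg i)) X :=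
  @reindex_mor k G C (hmg (cmp i) (dg i)) X (fun=> i) (fun=> idm (cmp i)) (fun=> erefl).

(** Naturality along the inclusions of two summands determines every entry with source (i, j), the
    zeros included. *)
Lemma family_ofE (b : braiding (crossed A)) X Y : fwd (br b X Y) = sum_family (family_of b) X Y.
Proof.
apply: sumHom_eq => -[i j] q.
have := br_nat b (summand i : @hom k (crossed A) _ _) (summand j : @hom k (crossed A) _ _).
pose XY := cr_ten A (hmg (cmp i) (dg i)) (hmg (cmp j) (dg j)).
move/(congr1 (fun f : sumHom XY (cr_ten A Y X) => f (tt, tt) q)).
change (@comp k (crossed A)) with (@sum_comp k G C).
change (@tenm k (crossed A)) with (@cr_tenm k G C A).
rewrite /summand !cr_tenm_reindex sum_comp_reindex /ucast !eqhom_refl !ten_id comp_id => ->.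
rewrite [LHS]sum_unit2 /= eqhom_refl !ten_id comp_id.
by case: q.
Qed.

Lemma family_of_natural (b : braiding (crossed A)) : hnatural (family_of b).
Proof.
move=> V V' W W' s t f g.
pose F := @reindex_mor k G C (hmg V s) (hmg V' s) (fun i => i) (fun=> f) (fun=> erefl).
pose K := @reindex_mor k G C (hmg W t) (hmg W' t) (fun i => i) (fun=> g) (fun=> erefl).
have := br_nat b (F : @hom k (crossed A) _ _) (K : @hom k (crossed A) _ _).
rewrite !family_ofE.
change (@comp k (crossed A)) with (@sum_comp k G C).
change (@tenm k (crossed A)) with (@cr_tenm k G C A).
rewrite /F /K /sum_family !cr_tenm_reindex !reindex_mor_comp.
by move=> /reindex_mor_inj/(_ (tt, tt)); rewrite /ucast /= !eqhom_refl.
Qed.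

Lemma family_of_hexagon1 (b : braiding (crossed A)) : hhexagon1 (family_of b).
Proof.
apply: hhexagon1_of => X Y Z; have := br_hexagon1 b X Y Z; rewrite !family_ofE.
exact.
Qed.

Lemma family_of_hexagon2 (b : braiding (crossed A)) : hhexagon2 (family_of b).
Proof.
apply: hhexagon2_of => X Y Z; have := br_hexagon2 b X Y Z; rewrite !family_ofE.
exact.
Qed.

Definition sum_familyV
    (h' : forall V s W t, hom (W ⊗ V ⊗ U t s) (V ⊗ W ⊗ U s t)) X Y :
    sumHom (cr_ten A Y X) (cr_ten A X Y) :=
  @reindex_mor k G C (cr_ten A Y X) (cr_ten A X Y) (fun p => (p.2, p.1))
    (fun p => h' (cmp p.2) (dg p.2) (cmp p.1) (dg p.1))
    (fun p => mulGC (dg p.2) (dg p.1)).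

Lemma sum_familyK (h : hfamily A)
    (h' : forall V s W t, hom (W ⊗ V ⊗ U t s) (V ⊗ W ⊗ U s t)) X Y :
  (forall V s W t, h' V s W t ∘ h V s W t = idm _) ->
  sum_comp (sum_familyV h' X Y) (sum_family h X Y) = sum_idm (cr_ten A X Y).
Proof.
move=> hK; rewrite /sum_familyV /sum_family reindex_mor_comp.
apply: sumHom_eq => -[i j] q /=; rewrite hK comp_id; by [].
Qed.

Lemma sum_familyVK (h : hfamily A)
    (h' : forall V s W t, hom (W ⊗ V ⊗ U t s) (V ⊗ W ⊗ U s t)) X Y :
  (forall V s W t, h V s W t ∘ h' V s W t = idm _) ->
  sum_comp (sum_family h X Y) (sum_familyV h' X Y) = sum_idm (cr_ten A Y X).
Proof.
move=> hK; rewrite /sum_familyV /sum_family reindex_mor_comp.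
apply: sumHom_eq => -[i j] q /=; rewrite hK comp_id; by [].
Qed.

Section BraidingOfFamily.
Variables (h : hfamily A) (h' : forall V s W t, hom (W ⊗ V ⊗ U t s) (V ⊗ W ⊗ U s t)).
Hypotheses (hK : forall V s W t, h' V s W t ∘ h V s W t = idm _)
  (h'K : forall V s W t, h V s W t ∘ h' V s W t = idm _)
  (h_nat : hnatural h) (h_hex1 : hhexagon1 h) (h_hex2 : hhexagon2 h).

Definition sum_iso (X Y : ob (crossed A)) : iso (X ⊗ Y) (Y ⊗ X) :=
  @Iso k (crossed A) _ _ (sum_family h X Y) (sum_familyV h' X Y)
    (sum_familyK X Y hK) (sum_familyVK X Y h'K).

Definition braiding_of : braiding (crossed A) :=
  @Braiding k (crossed A) sum_iso
    (fun X X' Y Y' f g => sum_family_nat f g h_nat)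
    (fun X Y Z => sum_hexagon1 X Y Z h_hex1)
    (fun X Y Z => sum_hexagon2 X Y Z h_hex2).

Lemma family_of_braiding_of V s W t : family_of braiding_of V s W t = h V s W t.
Proof. by rewrite /family_of /= delta_hom_id id_comp. Qed.

End BraidingOfFamily.

Lemma family_of_inj (b b' : braiding (crossed A)) :
  (forall V s W t, family_of b V s W t = family_of b' V s W t) -> b = b'.
Proof.
move=> e.
have eb : br b = br b'.
  apply: functional_extensionality_dep => X; apply: functional_extensionality_dep => Y.
  apply: iso_eq; [exact: sum_comp_idl|exact: sum_comp_idr|exact: sum_compA|].
  by rewrite !family_ofE; apply: reindex_mor_eq => p; apply: e.
case: b b' eb {e} => [b n1 x1 y1] [b' n2 x2 y2] /= eb; subst b'.
by rewrite (Prop_irrelevance n1 n2) (Prop_irrelevance x1 x2) (Prop_irrelevance y1 y2).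
Qed.

End CrossedProduct.

(** * Braidings on homogeneous objects give braidings of the action *)

Section StrictIdentities.
Variables (k : fieldType) (C : tensorCat k).
Implicit Types (a b : word C) (X Y T : ob C).

Fixpoint letters a : nat :=
  match a with Un _ _ => 0 | At _ => 1 | Ten a b => letters a + letters b end%N.

Lemma ev_unit a : letters a = 0%N -> ev a = unit_ob C.
Proof.
elim: a => //= a IHa b IHb /eqP; rewrite addn_eq0 => /andP[/eqP/IHa-> /eqP/IHb->].
exact: (ten1l (tc_unit C)).
Qed.

(** With at most one letter in the word, each associator met while flattening has I as one of its
    first two arguments. *)
Lemma fl_identity a T : (letters a <= 1)%N -> is_identity (fl a T).
Proof.
elim: a T => [J E|X|a IHa b IHb] T /= la.
- exact: is_identity_eqhom.
- exact: is_identity_idm.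
have la1 : (letters a <= 1)%N by apply: leq_trans la; apply: leq_addr.
have lb1 : (letters b <= 1)%N by apply: leq_trans la; apply: leq_addl.
apply: is_identity_comp.
  apply: is_identity_comp; first exact: IHa.
  by apply: is_identity_ten; [apply: is_identity_idm|apply: IHb].
case Ea: (letters a) la => [|n]; first by move=> _; apply/assocV_left_identity/ev_unit.
by rewrite addSn ltnS leqn0 addn_eq0 => /andP[_ /eqP Eb]; apply/assocV_mid_identity/ev_unit.
Qed.

Lemma strict_identity a b (f : hom (ev a) (ev b)) T :
  (letters a <= 1)%N -> (letters b <= 1)%N -> is_identity f -> is_identity (strict f T).
Proof.
move=> la lb idf; rewrite /strict unlock; apply: is_identity_comp.
  apply: is_identity_comp; first exact: fl_identity.
  by apply: is_identity_ten; [|apply: is_identity_idm].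
exact: is_identity_bwd (flK a T) (fl_identity T la).
Qed.

End StrictIdentities.

(** * Constraints that are identities because a degree is 1 or an object is I *)

Section CenterIdentities.
Variables (k : fieldType) (G : groupType) (C : tensorCat k).
Variable A : centralOuterAction G C.
Local Open Scope group_scope.
Local Notation U := (cU A).
Implicit Types (Z : ob C) (s t r : G).

Lemma zbr_unit_identity (X : zobj C) Z : Z = unit_ob C -> is_identity (fwd (zbr X Z)).
Proof. by move->; apply: zbr_unit. Qed.

Lemma zbr_cU1l s Z : is_identity (fwd (zbr (U 1 s) Z)).
Proof. by have [_] := cU1l A s; apply. Qed.

Lemma zbr_cU1r s Z : is_identity (fwd (zbr (U s 1) Z)).
Proof. by have [_] := cU1r A s; apply. Qed.

Lemma zbrV_identity (X : zobj C) Z :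
  is_identity (fwd (zbr X Z)) -> is_identity (bwd (zbr X Z)).
Proof. by apply: is_identity_bwd; apply: fwdK. Qed.

Lemma om_same s t r s' t' r' : s = s' -> t = t' -> r = r' ->
  same_mor (fwd (om A s t r)) (fwd (om A s' t' r')).
Proof. by move=> -> -> ->; apply: same_refl. Qed.

(* As for normalized 3-cocycles: up to identities, the coherence condition at
   (1, 1, r, m) says that omega_{1,r,m} is idempotent. *)
Lemma om_left_identity r m : is_identity (fwd (om A 1 r m)).
Proof.
have u1l := cU1l_ob A; have I1 := is_identity_idm (unit_ob C).
have idU s t := is_identity_idm (U s t : ob C).
have E : U 1 r ⊗ U (1 * r) m = U r m ⊗ U 1 (r * m) :> ob C.
  by rewrite !u1l mul1g (ten1l (tc_unit C)) (ten1r (tc_unit C)).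
apply: (idempotent_identity (E := E) (fwdK _)).
apply: (same_trans (g := fwd (om A (1 * 1) r m))).
  by apply: om_same; rewrite ?mul1g.
have := om_coherent A 1 1 r m; set lhs := (X in X = _); set rhs := (X in _ = X) => coh.
apply: (same_trans (g := rhs)).
  apply/same_sym; rewrite /rhs.
  apply: same_comp_idr; first exact: assocV_mid_identity.
  apply: same_comp_idr; first by apply: is_identity_ten => //; apply: om1.
  apply: same_comp_idr; first exact: assoc_mid_identity.
  apply: same_comp_idr; first by apply: is_identity_ten => //; apply: zbr_cU1l.
  apply: same_comp_idr; first exact: assocV_left_identity.
  by apply: same_comp_idl; [apply: assoc_left_identity|apply: unit_ten_same].
rewrite -coh {coh rhs} /lhs; apply: same_comp.
  apply: same_comp_idr; first exact: assocV_right_identity.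
  apply/same_sym/same_comp_idr; first exact: is_identity_eqhom.
  apply/same_sym; apply: same_comp_idl.
    apply: is_identity_comp; last exact: assoc_mid_identity.
    by apply: is_identity_ten; [apply: om1|apply: is_identity_eqhom].
  apply: (same_trans (g := fwd (om A 1 (1 * r) m))); first exact: unit_ten_same.
  by apply: om_same; rewrite ?mul1g.
by apply: ten_unit_same; [apply: is_identity_eqhom|].
Qed.

(** Up to identities, the coherence condition at (s, t, 1, 1) says that $\omega_{s,t,1}$ is
    idempotent. *)
Lemma om_right_identity s t : is_identity (fwd (om A s t 1)).
Proof.
have u1r := cU1r_ob A; have I1 := is_identity_idm (unit_ob C).
have idU s t := is_identity_idm (U s t : ob C).
have E : U s t ⊗ U (s * t) 1 = U t 1 ⊗ U s (t * 1) :> ob C.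
  by rewrite !u1r mulg1 (ten1l (tc_unit C)) (ten1r (tc_unit C)).
apply: (idempotent_identity (E := E) (fwdK _)).
apply: (same_trans (g := fwd (om A s t (1 * 1)))).
  by apply: om_same; rewrite ?mul1g.
have := om_coherent A s t 1 1; set lhs := (X in X = _); set rhs := (X in _ = X) => coh.
apply: (same_trans (g := rhs)).
  apply/same_sym; rewrite /rhs.
  apply: same_comp_idr; first exact: assocV_left_identity.
  apply: same_comp_idl; last exact: unit_ten_same.
  apply: is_identity_comp; last exact: assoc_left_identity.
  apply: is_identity_comp.
    apply: is_identity_comp; last exact: assocV_mid_identity.
    apply: is_identity_comp; first exact: assoc_right_identity.
    by apply: is_identity_ten => //; apply: om1.
  by apply: is_identity_ten => //; apply: zbr_unit_identity.
rewrite -coh {coh rhs} /lhs.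
apply: same_comp_idr; first by apply: is_identity_ten; [apply: om1|apply: is_identity_eqhom].
apply: same_comp_idr; first exact: assocV_left_identity.
apply: same_comp.
  apply: same_comp_idr; first exact: assoc_right_identity.
  apply/same_sym/same_comp_idr; first exact: is_identity_eqhom.
  by apply/same_sym/ten_unit_same; first exact: is_identity_eqhom.
apply: (same_trans (g := fwd (om A s (t * 1) 1))); first exact: unit_ten_same.
by apply: om_same; rewrite ?mulg1.
Qed.

Lemma omg_mid_identity s r st tr (E1 : s * 1 = st) (E2 : 1 * r = tr) :
  is_identity (omg A E1 E2).
Proof. by case: _ / E1; case: _ / E2; apply: om1. Qed.

Lemma omg_left_identity t r st tr (E1 : 1 * t = st) (E2 : t * r = tr) :
  is_identity (omg A E1 E2).
Proof. by case: _ / E1; case: _ / E2; apply: om_left_identity. Qed.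

Lemma omg_right_identity s t st tr (E1 : s * t = st) (E2 : t * 1 = tr) :
  is_identity (omg A E1 E2).
Proof. by case: _ / E1; case: _ / E2; apply: om_right_identity. Qed.

Lemma omgK s t r st tr (E1 : s * t = st) (E2 : t * r = tr) :
  omgV A E1 E2 ∘ omg A E1 E2 = idm _.
Proof. by case: _ / E1; case: _ / E2; apply: fwdK. Qed.

Lemma omgV_identity s t r st tr (E1 : s * t = st) (E2 : t * r = tr) :
  is_identity (omg A E1 E2) -> is_identity (omgV A E1 E2).
Proof. exact/is_identity_bwd/omgK. Qed.

(** The second hexagon writes the braiding with I ⊗ I as a square, and naturality along I ⊗ I → I
    makes this square equal to the braiding with I, which is invertible. *)
Lemma br_unit_r (c : braiding C) (a : word C) T :
  strict (a := Ten a (Un (erefl (unit_ob C)))) (b := Ten (Un erefl) a)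
    (fwd (br c (ev a) (unit_ob C))) T = idm _.
Proof.
pose I := Un (erefl (unit_ob C)); set x := LHS.
have e : x ∘ x = x.
  have := brS_tenr c a I I T => /= <-.
  have N := br_nat c (idm (ev a)) (lun (erefl (unit_ob C)) (unit_ob C)).
  by strict_hyp C N T; move: NS; rewrite ?(nfm_id, comp_id, id_comp) => <-.
have K : strict (a := Ten (Un erefl) a) (b := Ten a (Un (erefl (unit_ob C))))
  (bwd (br c (ev a) (unit_ob C))) T ∘ x = idm _.
  exact: (strict_bwd (a := Ten a I) (b := Ten I a) _ (fwdK _)).
by rewrite -[RHS]K -{2}e -comp_assoc K id_comp.
Qed.

Lemma br_unit_l (c : braiding C) (a : word C) T :
  strict (a := Ten (Un (erefl (unit_ob C))) a) (b := Ten a (Un erefl))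
    (fwd (br c (unit_ob C) (ev a))) T = idm _.
Proof.
pose I := Un (erefl (unit_ob C)); set x := LHS.
have e : x ∘ x = x.
  have := brS_tenl c I I a T => /= <-.
  have N := br_nat c (lun (erefl (unit_ob C)) (unit_ob C)) (idm (ev a)).
  by strict_hyp C N T; move: NS; rewrite ?(nfm_id, comp_id, id_comp) => <-.
have K : strict (a := Ten a (Un erefl)) (b := Ten (Un (erefl (unit_ob C))) a)
  (bwd (br c (unit_ob C) (ev a))) T ∘ x = idm _.
  exact: (strict_bwd (a := Ten I a) (b := Ten a I) _ (fwdK _)).
by rewrite -[RHS]K -{2}e -comp_assoc K id_comp.
Qed.

End CenterIdentities.

Ltac solve_identity :=
  first
  [ apply: omg_mid_identity | apply: omg_left_identity | apply: omg_right_identity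
  | apply: omgV_identity; solve_identity
  | apply: zbr_cU1l | apply: zbr_cU1r | exact: zbr_unit_identity
  | apply: zbrV_identity; solve_identity ].

(** In a hexagon taken at degree 1 or at I, this erases the half-braidings and [omg] that are
    identities, and the braiding of C with I. *)
Ltac strict_identities H :=
  repeat match type of H with
  | context [@strict ?k ?C ?a ?b ?f ?T] =>
    let e := fresh "e" in
    assert (e : @strict k C a b f T = idm (nf a T));
    [ solve [ apply: is_identity_eq; [| exact: is_identity_idm];
              apply: strict_identity => //; solve_identity ]
    | cbn [nf] in e; rewrite {}e in H ]
  end;
  rewrite ?(br_unit_l, br_unit_r) in H;
  rewrite ?(ten_id, comp_id, id_comp, nfm_id, whisker_comp, comp_assoc) in H.

(** * Twists extracted from a family, and the axioms they satisfy *)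

Section FromFamily.
Variables (k : fieldType) (G : groupType) (C : tensorCat k).
Hypothesis mulGC : forall s t : G, (s * t = t * s)%g.
Variables (c : braiding C) (A : centralOuterAction G C).
Local Open Scope group_scope.
Local Notation U := (cU A).
Local Notation I := (unit_ob C).
Local Notation EI := (erefl (unit_ob C)).
Implicit Types (V W X Y Z T : ob C) (s t r : G).

Variables (h : hfamily A) (h' : forall V s W t, hom (W ⊗ V ⊗ U t s) (V ⊗ W ⊗ U s t)).
Hypotheses (hK : forall V s W t, h' V s W t ∘ h V s W t = idm _)
  (h'K : forall V s W t, h V s W t ∘ h' V s W t = idm _)
  (h_nat : hnatural h) (h_hex1 : hhexagon1 h) (h_hex2 : hhexagon2 h)
  (h_br : forall V W, h V 1 W 1 = fwd (br c V W) ▷ U 1 1).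

Definition fam_th t V : hom V V :=
  run (cU1r_ob A t) V ∘ (lun EI V ▷ U t 1) ∘ h V 1 I t
    ∘ (runV EI V ▷ U 1 t) ∘ runV (cU1l_ob A t) V.

Definition fam_thb s W : hom W W :=
  run (cU1l_ob A s) W ∘ (run EI W ▷ U 1 s) ∘ h I s W 1
    ∘ (lunV EI W ▷ U s 1) ∘ runV (cU1r_ob A s) W.

Definition fam_tw s t : hom (U s t) (U t s) :=
  lun EI (U t s) ∘ (lun EI I ▷ U t s) ∘ h I s I t ∘ (lunV EI I ▷ U s t) ∘ lunV EI (U s t).

(** The argument is a word because it will also be a product V ⊗ W or the unit. *)
Lemma fam_thE t a T :
  strict (a := Ten (Ten a (Un EI)) (Un (cU1l_ob A t)))
    (b := Ten (Ten (Un EI) a) (Un (cU1r_ob A t))) (h (ev a) 1 I t) T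
  = strict (a := a) (b := a) (fam_th t (ev a)) T.
Proof.
(* Unfolding one side of a trivial equation and strictifying it exposes [h] without its unit
   maps. *)
have H : fam_th t (ev a) = fam_th t (ev a) by [].
rewrite {2}/fam_th in H; strict_hyp C H T.
by rewrite HS !(nfm_id, id_comp, comp_id).
Qed.

Lemma fam_thbE s a T :
  strict (a := Ten (Ten (Un EI) a) (Un (cU1r_ob A s)))
    (b := Ten (Ten a (Un EI)) (Un (cU1l_ob A s))) (h I s (ev a) 1) T
  = strict (a := a) (b := a) (fam_thb s (ev a)) T.
Proof.
have H : fam_thb s (ev a) = fam_thb s (ev a) by [].
rewrite {2}/fam_thb in H; strict_hyp C H T.
by rewrite HS !(nfm_id, id_comp, comp_id).
Qed.

Lemma fam_twE s t T :
  strict (a := Ten (Ten (Un EI) (Un EI)) (At (U s t)))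
    (b := Ten (Ten (Un EI) (Un EI)) (At (U t s))) (h I s I t) T
  = fam_tw s t ▷ T.
Proof.
have H : fam_tw s t = fam_tw s t by [].
rewrite {2}/fam_tw in H; strict_hyp C H T.
by move: HS; rewrite strict_At !(ten_id, id_comp, comp_id).
Qed.

(* The hexagon for [V, 1], [I, s] and [W, t], where [V, s] = [V, 1].[I, s]. *)
Lemma fam_splitl V s W t T :
  bS h V s W t T = strict (a := Ten (Ten (At V) (At W)) (Un (cU1l_ob A t)))
     (b := Ten (Ten (At W) (At V)) (Un (cU1r_ob A t))) (h V 1 W t) (U t s ⊗ T)
   ∘ (V ◁ strict (a := Ten (Ten (Un EI) (At W)) (At (U s t)))
        (b := Ten (Ten (At W) (Un EI)) (At (U t s))) (h I s W t) T).
Proof.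
have H := h_hex1 V I W (mul1g s) (erefl (s * t)) (mulGC t s) (mulg1 t) (mul1g t).
rewrite /hassoc in H; strict_hyp C H T; strict_identities HS.
have N := h_nat s t (run (cU1l_ob A s) V ∘ (run EI V ▷ U 1 s)) (idm W).
strict_hyp C N T; rewrite -HS; move: NS.
by rewrite ?(ten_id, id_comp, comp_id) => <-.
Qed.

(* The hexagon for [I, s], [W, 1] and [I, t]. *)
Lemma fam_splitr W s t T :
  strict (a := Ten (Ten (Un EI) (At W)) (At (U s t)))
        (b := Ten (Ten (At W) (Un EI)) (At (U t s))) (h I s W t) T
  = (W ◁ (fam_tw s t ▷ T)) ∘ (fam_thb s W ▷ (U s t ⊗ T)).
Proof.
have H := h_hex2 I W I (mulg1 s) (mul1g s) (mul1g t) (erefl (t * s)) (mulGC s t).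
rewrite /hassocV in H; strict_hyp C H T; strict_identities HS.
have N := h_nat s t (idm I) (run (cU1l_ob A t) W ∘ (run EI W ▷ U 1 t)).
strict_hyp C N T; move: NS; rewrite ?(ten_id, id_comp, comp_id) => ->.
by rewrite HS fam_twE (fam_thbE s (At W)) strict_At.
Qed.

(* The hexagon for [V, 1], [W, 1] and [I, t]. *)
Lemma fam_splitm V W t T :
  strict (a := Ten (Ten (At V) (At W)) (Un (cU1l_ob A t)))
     (b := Ten (Ten (At W) (At V)) (Un (cU1r_ob A t))) (h V 1 W t) T
  = (W ◁ (fam_th t V ▷ T)) ∘ brS c V W T.
Proof.
have H := h_hex2 V W I (mul1g 1) (mul1g 1) (mul1g t) (mulg1 t) (mul1g t).
rewrite /hassocV h_br in H; strict_hyp C H T; strict_identities HS.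
have N := h_nat 1 t (idm V) (run (cU1l_ob A t) W ∘ (run EI W ▷ U 1 t)).
strict_hyp C N T; move: NS; rewrite ?(ten_id, id_comp, comp_id) => ->.
by rewrite HS (fam_thE t (At V)) strict_At.
Qed.

(** Three splittings leave the components at ([V, 1], [W, 1]), ([V, 1], [I, t]), ([I, s], [W, 1])
    and ([I, s], [I, t]). The first of them is c by [h_br]; the others define the twists. *)
Lemma famE V s W t :
  h V s W t = (fwd (br c V W) ∘ (fam_th t V ⊠ fam_thb s W)) ⊠ fam_tw s t.
Proof.
strict_goal C; rewrite -/(bS _ _ _ _ _ _) fam_splitl fam_splitm fam_splitr.
rewrite !(ten_id, id_comp, comp_id, strict_At) -/(brS _ _ _ _) -brS_natl.
by rewrite -interchange whisker_comp !comp_assoc.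
Qed.

Lemma fam_th_nat t V V' (f : hom V V') : fam_th t V' ∘ f = f ∘ fam_th t V.
Proof.
strict_goal C; have H := h_nat 1 t f (idm I); strict_hyp C H T; move: HS.
by rewrite !(fam_thE t (At _)) ?(ten_id, id_comp, comp_id).
Qed.

Lemma fam_thb_nat s W W' (f : hom W W') : fam_thb s W' ∘ f = f ∘ fam_thb s W.
Proof.
strict_goal C; have H := h_nat s 1 (idm I) f; strict_hyp C H T; move: HS.
by rewrite !(fam_thbE s (At _)) ?(ten_id, id_comp, comp_id).
Qed.

(** The first hexagon for [V, 1], [W, 1] and [I, t]. *)
Lemma fam_th_ten t V W : fam_th t (V ⊗ W) = fam_th t V ⊠ fam_th t W.
Proof.
strict_goal C.
have H := h_hex1 V W I (mul1g 1) (mul1g t) (mulg1 t) (mulg1 t) (mul1g t).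
rewrite /hassoc in H; strict_hyp C H T; strict_identities HS.
have N := h_nat 1 t (run (cU1l_ob A 1) (V ⊗ W)) (idm I).
strict_hyp C N T; move: NS; rewrite ?(ten_id, id_comp, comp_id) HS.
by rewrite (fam_thE t (Ten (At V) (At W))) !(fam_thE t (At _)).
Qed.

(** The second hexagon for [I, s], [V, 1] and [W, 1]. *)
Lemma fam_thb_ten s V W : fam_thb s (V ⊗ W) = fam_thb s V ⊠ fam_thb s W.
Proof.
strict_goal C.
have H := h_hex2 I V W (mulg1 s) (mul1g s) (mul1g 1) (mul1g s) (mulg1 s).
rewrite /hassocV in H; strict_hyp C H T; strict_identities HS.
have N := h_nat s 1 (idm I) (run (cU1l_ob A 1) (V ⊗ W)).
strict_hyp C N T; move: NS; rewrite ?(ten_id, id_comp, comp_id) HS.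
rewrite (fam_thbE s (Ten (At V) (At W))) !(fam_thbE s (At _)) => ->.
by rewrite !strict_At interchange.
Qed.

Lemma fam_th1 V : fam_th 1 V = idm V.
Proof.
(* Reification reads $U_{1,1}$ through [cU1l_ob], whereas [fam_th] contains [cU1r_ob]; the two
   proofs are identified so that the words agree. *)
rewrite /fam_th h_br (Prop_irrelevance (cU1r_ob A 1) (cU1l_ob A 1)).
by strict_goal C; rewrite br_unit_r !(ten_id, id_comp, comp_id).
Qed.

Lemma fam_thb1 V : fam_thb 1 V = idm V.
Proof.
rewrite /fam_thb h_br (Prop_irrelevance (cU1r_ob A 1) (cU1l_ob A 1)).
by strict_goal C; rewrite br_unit_l !(ten_id, id_comp, comp_id).
Qed.

Definition fam_thV t V : hom V V :=
  run (cU1l_ob A t) V ∘ (run EI V ▷ U 1 t) ∘ h' V 1 I t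
    ∘ (lunV EI V ▷ U t 1) ∘ runV (cU1r_ob A t) V.

Definition fam_thbV s W : hom W W :=
  run (cU1r_ob A s) W ∘ (lun EI W ▷ U s 1) ∘ h' I s W 1
    ∘ (runV EI W ▷ U 1 s) ∘ runV (cU1l_ob A s) W.

Definition fam_twV s t : hom (U t s) (U s t) :=
  lun EI (U s t) ∘ (lun EI I ▷ U s t) ∘ h' I s I t ∘ (lunV EI I ▷ U t s) ∘ lunV EI (U t s).

Lemma fam_thK t V : fam_thV t V ∘ fam_th t V = idm _.
Proof.
rewrite /fam_thV /fam_th; strict_goal C; have H := hK V 1 I t; strict_hyp C H T.
by rewrite ?(ten_id, comp_id, id_comp).
Qed.

Lemma fam_thVK t V : fam_th t V ∘ fam_thV t V = idm _.
Proof.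
rewrite /fam_thV /fam_th; strict_goal C; have H := h'K V 1 I t; strict_hyp C H T.
by rewrite ?(ten_id, comp_id, id_comp).
Qed.

Lemma fam_thbK s W : fam_thbV s W ∘ fam_thb s W = idm _.
Proof.
rewrite /fam_thbV /fam_thb; strict_goal C; have H := hK I s W 1; strict_hyp C H T.
by rewrite ?(ten_id, comp_id, id_comp).
Qed.

Lemma fam_thbVK s W : fam_thb s W ∘ fam_thbV s W = idm _.
Proof.
rewrite /fam_thbV /fam_thb; strict_goal C; have H := h'K I s W 1; strict_hyp C H T.
by rewrite ?(ten_id, comp_id, id_comp).
Qed.

Lemma fam_twK s t : fam_twV s t ∘ fam_tw s t = idm _.
Proof.
rewrite /fam_twV /fam_tw; strict_goal C; have H := hK I s I t; strict_hyp C H T.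
by rewrite ?(ten_id, comp_id, id_comp).
Qed.

Lemma fam_twVK s t : fam_tw s t ∘ fam_twV s t = idm _.
Proof.
rewrite /fam_twV /fam_tw; strict_goal C; have H := h'K I s I t; strict_hyp C H T.
by rewrite ?(ten_id, comp_id, id_comp).
Qed.

(** Monoidality and naturality along I ⊗ I → I make this invertible morphism idempotent. *)
Lemma fam_th_unit t : fam_th t I = idm I.
Proof.
have xx : fam_th t I ∘ fam_th t I = fam_th t I.
  strict_goal C; have H := fam_th_nat t (lun EI I); rewrite fam_th_ten in H.
  by strict_hyp C H T; move: HS; rewrite !(id_comp, comp_id).
by rewrite -[LHS]id_comp -(fam_thK t I) comp_assoc xx.
Qed.

Lemma fam_thb_unit t : fam_thb t I = idm I.
Proof.
have xx : fam_thb t I ∘ fam_thb t I = fam_thb t I.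
  strict_goal C; have H := fam_thb_nat t (lun EI I); rewrite fam_thb_ten in H.
  by strict_hyp C H T; move: HS; rewrite !(id_comp, comp_id).
by rewrite -[LHS]id_comp -(fam_thbK t I) comp_assoc xx.
Qed.

Lemma is_identity_strict a b (f : hom (ev a) (ev b)) (E : ev a = ev b) :
  (letters a <= 1)%N -> (letters b <= 1)%N ->
  (forall T, is_identity (strict f T)) -> is_identity f.
Proof.
move=> la lb idf; suff -> : f = eqhom E by apply: is_identity_eqhom.
apply: strict_inj => T; apply: is_identity_eq => //.
by apply: strict_identity => //; apply: is_identity_eqhom.
Qed.

(** The component $b_{[I,1],[I,t]}$ defines both $t_{1,t}$ and [fam_th t] at I, and the latter is
    trivial. *)
Lemma fam_tw_left_identity t : is_identity (fam_tw 1 t).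
Proof.
apply: (@is_identity_strict (Un (cU1l_ob A t)) (Un (cU1r_ob A t))) => // [|T].
  by rewrite /= cU1l_ob cU1r_ob.
have H : fam_tw 1 t = fam_tw 1 t by [].
rewrite {2}/fam_tw in H; strict_hyp C H T; rewrite HS !(id_comp, comp_id).
have := fam_thE t (Un EI) T => /= ->; rewrite fam_th_unit strict_id.
exact: is_identity_idm.
Qed.

Lemma fam_tw_right_identity t : is_identity (fam_tw t 1).
Proof.
apply: (@is_identity_strict (Un (cU1r_ob A t)) (Un (cU1l_ob A t))) => // [|T].
  by rewrite /= cU1l_ob cU1r_ob.
have H : fam_tw t 1 = fam_tw t 1 by [].
rewrite {2}/fam_tw in H; strict_hyp C H T; rewrite HS !(id_comp, comp_id).
have := fam_thbE t (Un EI) T => /= ->; rewrite fam_thb_unit strict_id.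
exact: is_identity_idm.
Qed.

Lemma fam_tw_leftS t T :
  strict (a := Un (cU1l_ob A t)) (b := Un (cU1r_ob A t)) (fam_tw 1 t) T = idm _.
Proof.
apply: is_identity_eq; last exact: is_identity_idm.
by apply: strict_identity => //; apply: fam_tw_left_identity.
Qed.

Lemma fam_tw_rightS t T :
  strict (a := Un (cU1r_ob A t)) (b := Un (cU1l_ob A t)) (fam_tw t 1) T = idm _.
Proof.
apply: is_identity_eq; last exact: is_identity_idm.
by apply: strict_identity => //; apply: fam_tw_right_identity.
Qed.

(** The first hexagon for [I, s], [I, t] and [Z, 1]. Its component at $[U_{s,t}, st]$ and [Z, 1] is
    given by [famE], where [fam_th 1] and [fam_tw st 1] are trivial. *)
Lemma famB1 s t st Z : s * t = st ->
  fwd (br c (U s t) Z) ∘ (U s t ◁ fam_thb st Z) ∘ fwd (zbr (U s t) Z)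
  = (fam_thb s Z ∘ fam_thb t Z) ▷ U s t.
Proof.
move=> E; strict_goal C.
have H := h_hex1 I I Z E (mulg1 t) (mul1g t) (mul1g s) (mulg1 s).
rewrite /hassoc in H; strict_hyp C H T; strict_identities HS.
have N := h_nat st 1 (lun EI (U s t) ∘ (lun EI I ▷ U s t)) (idm Z).
have P := famE (U s t) st Z 1; rewrite fam_th1 in P.
strict_hyp C N T; strict_hyp C P T; move: PS NS.
rewrite fam_tw_rightS ?(ten_id, comp_id, id_comp) => -> NS.
by rewrite ?(ten_id, comp_id, id_comp) NS HS !(fam_thbE _ (At Z)).
Qed.

(** The second hexagon for [Z, 1], [I, s] and [I, t]. *)
Lemma famB2 s t st Z : s * t = st ->
  bwd (zbr (U s t) Z) ∘ fwd (br c Z (U s t)) ∘ (fam_th st Z ▷ U s t)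
  = (fam_th s Z ∘ fam_th t Z) ▷ U s t.
Proof.
move=> E; strict_goal C.
have H := h_hex2 Z I I (mul1g s) (mulg1 s) E (mulg1 t) (mul1g t).
rewrite /hassocV in H; strict_hyp C H T; strict_identities HS.
have N := h_nat 1 st (idm Z) (lun EI (U s t) ∘ (lun EI I ▷ U s t)).
have P := famE Z 1 (U s t) st; rewrite fam_thb1 in P.
strict_hyp C N T; strict_hyp C P T; move: PS NS.
rewrite fam_tw_leftS ?(ten_id, comp_id, id_comp) => -> NS.
rewrite ?(ten_id, comp_id, id_comp) comp_assoc NS HS !(fam_thE _ (At Z)).
by rewrite !strict_At -!comp_whisker fam_th_nat.
Qed.

(** The first hexagon for [I, s], [I, t] and [I, r]: with all objects equal to I, only the objects U
    remain, and [fam_thb] and c are trivial on I. *)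
Lemma famB3 s t r st tr rs
    (E1 : s * t = st) (E2 : t * r = tr) (E2' : r * t = tr)
    (E3 : r * s = rs) (E3' : s * r = rs) :
  omg A E3 E1 ∘ (fam_th r (U s t) ⊠ fam_tw st r) ∘ omg A E1 E2
  = (fam_tw s r ▷ U rs t) ∘ omg A E3' E2' ∘ (fam_tw t r ▷ U s tr).
Proof.
strict_goal C.
have H := h_hex1 I I I E1 E2 E2' E3 E3'.
rewrite /hassoc in H; strict_hyp C H T; strict_identities HS.
have N := h_nat st r (lun EI (U s t) ∘ (lun EI I ▷ U s t)) (idm I).
have P := famE (U s t) st I r; rewrite fam_thb_unit in P.
strict_hyp C N T; strict_hyp C P T; move: PS NS.
rewrite br_unit_r !strict_At ?(ten_id, comp_id, id_comp) => -> NS.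
rewrite !fam_twE in HS.
by rewrite ?(ten_id, comp_id, id_comp) NS !comp_assoc.
Qed.

(** The second hexagon for the same three objects, [fam_th] being trivial on I. *)
Lemma famB4 s t r st tr rs
    (E1 : s * t = st) (E1' : t * s = st) (E2 : t * r = tr)
    (E3 : r * s = rs) (E3' : s * r = rs) :
  omgV A E2 E3 ∘ (fam_thb s (U t r) ⊠ fam_tw s tr) ∘ omgV A E1 E2
  = (fam_tw s r ▷ U t rs) ∘ omgV A E1' E3' ∘ (fam_tw s t ▷ U st r).
Proof.
strict_goal C.
have H := h_hex2 I I I E1 E1' E2 E3 E3'.
rewrite /hassocV in H; strict_hyp C H T; strict_identities HS.
have N := h_nat s tr (idm I) (lun EI (U t r) ∘ (lun EI I ▷ U t r)).
have P := famE I s (U t r) tr; rewrite fam_th_unit in P.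
strict_hyp C N T; strict_hyp C P T; move: PS NS.
rewrite br_unit_l !strict_At ?(ten_id, comp_id, id_comp) => -> NS.
rewrite !fam_twE in HS.
by rewrite ?(ten_id, comp_id, id_comp) NS !comp_assoc.
Qed.

End FromFamily.

(** * The braiding of the action attached to a family *)

Section ActionOfFamily.
Variables (k : fieldType) (G : groupType) (C : tensorCat k).
Hypothesis mulGC : forall s t : G, (s * t = t * s)%g.
Variables (c : braiding C) (A : centralOuterAction G C).
Local Open Scope group_scope.
Local Notation U := (cU A).
Implicit Types (V W X Y Z T : ob C) (s t r : G).

Variables (h : hfamily A) (h' : forall V s W t, hom (W ⊗ V ⊗ U t s) (V ⊗ W ⊗ U s t)).
Hypotheses (hK : forall V s W t, h' V s W t ∘ h V s W t = idm _)
  (h'K : forall V s W t, h V s W t ∘ h' V s W t = idm _)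
  (h_nat : hnatural h) (h_hex1 : hhexagon1 h) (h_hex2 : hhexagon2 h)
  (h_br : forall V W, h V 1 W 1 = fwd (br c V W) ▷ U 1 1).

Definition act_th t : monNatAut C := @MonNatAut k C
  (fun V => Iso (fam_thK hK t V) (fam_thVK h'K t V))
  (fun V V' f => fam_th_nat h_nat t f)
  (fun V W => fam_th_ten h_nat h_hex1 t V W)
  (fam_th_unit hK h_nat h_hex1 t).

Definition act_thb s : monNatAut C := @MonNatAut k C
  (fun V => Iso (fam_thbK hK s V) (fam_thbVK h'K s V))
  (fun V V' f => fam_thb_nat h_nat s f)
  (fun V W => fam_thb_ten h_nat h_hex2 s V W)
  (fam_thb_unit hK h_nat h_hex2 s).

Definition act_tw s t : iso (U s t) (U t s) :=
  Iso (fam_twK hK s t) (fam_twVK h'K s t).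

Lemma na_bwd_nat (u : monNatAut C) X Y (f : hom X Y) :
  bwd (u Y) ∘ f = f ∘ bwd (u X).
Proof.
rewrite -[RHS]id_comp -(fwdK (u Y)) comp_assoc -(comp_assoc _ f) na_nat.
by rewrite comp_assoc bwdK comp_id.
Qed.

Lemma act_B1 s t Z :
  fwd (br c (U s t) Z) ∘ fwd (zbr (U s t) Z) =
  (bwd (act_thb (s * t) Z) ∘ fwd (act_thb s Z) ∘ fwd (act_thb t Z)) ▷ U s t.
Proof.
rewrite comp_assoc na_bwd_nat comp_whisker.
rewrite -(famB1 mulGC hK h_nat h_hex1 h_hex2 h_br Z (erefl (s * t))).
rewrite !comp_assoc zbr_nat -(comp_assoc (_ ◁ _)) -whisker_comp.
by rewrite (bwdK (act_thb (s * t) Z)) ten_id id_comp.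
Qed.

Lemma act_B2 s t Z :
  bwd (zbr (U s t) Z) ∘ fwd (br c Z (U s t)) =
  (bwd (act_th (s * t) Z) ∘ fwd (act_th s Z) ∘ fwd (act_th t Z)) ▷ U s t.
Proof.
rewrite comp_assoc na_bwd_nat comp_whisker.
rewrite -(famB2 mulGC hK h_nat h_hex1 h_hex2 h_br Z (erefl (s * t))).
rewrite !comp_assoc -comp_whisker.
by rewrite (bwdK (act_th (s * t) Z)) ten_id comp_id.
Qed.

Lemma act_tw_central s t : central (hb (U s t)) (hb (U t s)) (fwd (act_tw s t)).
Proof.
move=> Z; rewrite /hb /=.
have K X : bwd (br c X Z) ∘ fwd (br c X Z) = idm _ by apply: fwdK.
rewrite -[LHS]id_comp -[RHS]id_comp -(K (U t s)) !comp_assoc; congr (_ ∘ _).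
rewrite -!(comp_assoc (fwd (br _ _ _))) br_nat (comp_assoc _ (fwd (br _ _ _))).
rewrite !act_B1 ten_comp -interchange ten_comp id_comp comp_id.
rewrite comp_id (mulGC t s); congr (_ ⊠ _).
rewrite (comp_assoc _ (fwd (act_thb t Z))) (comp_assoc _ (fwd (act_thb s Z))).
(* Natural automorphisms of the identity functor commute, so the right-hand side of (B1) is
   symmetric in s and t. *)
congr (_ ∘ _); exact: na_nat.
Qed.

Lemma act_B3 s t r :
  fwd (om A r s t) ∘ (fwd (act_th r (U s t)) ⊠ fwd (act_tw (s * t) r)) ∘ fwd (om A s t r) =
  (fwd (act_tw s r) ⊠ ucast U (mulGC s r) (erefl t)) ∘ fwd (om A s r t)
    ∘ (fwd (act_tw t r) ⊠ ucast U (erefl s) (mulGC t r)).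
Proof.
have := famB3 mulGC hK h_nat h_hex1 h_hex2 h_br (erefl (s * t))
  (erefl (t * r)) (mulGC r t) (erefl (r * s)) (mulGC s r).
rewrite /= => ->; rewrite omg_cast -!comp_assoc ten_comp comp_id id_comp.
rewrite (comp_assoc _ _ (fam_tw _ _ _ ▷ _)) ten_comp comp_id id_comp.
by congr (_ ⊠ _ ∘ _ ∘ (_ ⊠ _)); apply: eqhom_irr.
Qed.

Lemma act_B4 s t r :
  bwd (om A t r s) ∘ (fwd (act_thb s (U t r)) ⊠ fwd (act_tw s (t * r))) ∘ bwd (om A s t r) =
  (fwd (act_tw s r) ⊠ ucast U (erefl t) (mulGC s r)) ∘ bwd (om A t s r)
    ∘ (fwd (act_tw s t) ⊠ ucast U (mulGC s t) (erefl r)).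
Proof.
have := famB4 mulGC hK h_nat h_hex1 h_hex2 h_br (erefl (s * t))
  (mulGC t s) (erefl (t * r)) (erefl (r * s)) (mulGC s r).
rewrite /= => ->; rewrite omgV_cast -!comp_assoc ten_comp comp_id id_comp.
rewrite (comp_assoc _ _ (fam_tw _ _ _ ▷ _)) ten_comp comp_id id_comp.
by congr (_ ⊠ _ ∘ _ ∘ (_ ⊠ _)); apply: eqhom_irr.
Qed.

Definition action_of : actionBraiding mulGC c A :=
  @ActionBraiding k G C mulGC c A act_th act_thb act_tw act_tw_central
    (fam_th1 h_br) (fam_thb1 h_br) (fam_th_unit hK h_nat h_hex1)
    (fam_tw_right_identity hK h_nat h_hex2) (fam_tw_left_identity hK h_nat h_hex1)
    act_B1 act_B2 act_B3 act_B4.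

Lemma prod_family_action_of V s W t : prod_family action_of V s W t = h V s W t.
Proof. by rewrite (famE mulGC h_nat h_hex1 h_hex2 h_br). Qed.

End ActionOfFamily.

(** * A braiding of the action is recovered from its family *)

Section Uniqueness.
Variables (k : fieldType) (G : groupType) (C : tensorCat k).
Hypothesis mulGC : forall s t : G, (s * t = t * s)%g.
Variables (c : braiding C) (A : centralOuterAction G C).
Local Open Scope group_scope.
Local Notation U := (cU A).
Local Notation I := (unit_ob C).
Implicit Types (B : actionBraiding mulGC c A) (V W Z : ob C) (s t : G).

(** In the product formula [thb 1], $t_{1,t}$ and $c_{V,I}$ are trivial, which leaves [th t]. *)
Lemma prod_family_th B t V : fam_th (prod_family B) t V = fwd (th B t V).
Proof.
rewrite /fam_th /prod_family /brt thb1; strict_goal C.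
have -> : strict (a := Un (cU1l_ob A t)) (b := Un (cU1r_ob A t)) (fwd (tw B 1 t)) T = idm _.
  apply: is_identity_eq; last exact: is_identity_idm.
  by apply: strict_identity => //; apply: tw1l.
by rewrite br_unit_r !(ten_id, comp_id, id_comp).
Qed.

Lemma prod_family_thb B s W : fam_thb (prod_family B) s W = fwd (thb B s W).
Proof.
rewrite /fam_thb /prod_family /brt th1; strict_goal C.
have -> : strict (a := Un (cU1r_ob A s)) (b := Un (cU1l_ob A s)) (fwd (tw B s 1)) T = idm _.
  apply: is_identity_eq; last exact: is_identity_idm.
  by apply: strict_identity => //; apply: tw1r.
by rewrite br_unit_l !(ten_id, comp_id, id_comp).
Qed.

(** Both twists are trivial on I, and so is the braiding of I with itself. *)
Lemma prod_family_tw B s t : fam_tw (prod_family B) s t = fwd (tw B s t).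
Proof.
rewrite /fam_tw /prod_family /brt th_unit na_unit; strict_goal C.
rewrite (br_unit_r c (Un (erefl I))) !(ten_id, comp_id, id_comp).
by [].
Qed.

Lemma iso_eq_tensor X Y (f g : @iso k C X Y) : fwd f = fwd g -> f = g.
Proof. by apply: iso_eq => *; rewrite ?id_comp ?comp_id ?comp_assoc. Qed.

Lemma monNatAut_eq (u v : monNatAut C) : (forall Z, fwd (u Z) = fwd (v Z)) -> u = v.
Proof.
move=> e; have euv : na u = na v.
  by apply: functional_extensionality_dep => Z; apply/iso_eq_tensor/e.
case: u v euv {e} => [u n1 t1 u1] [v n2 t2 u2] /= euv; subst v.
by rewrite (Prop_irrelevance n1 n2) (Prop_irrelevance t1 t2) (Prop_irrelevance u1 u2).
Qed.

(** The family yields the three data fields; the remaining fields are propositions. *)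
Lemma prod_family_inj B B' :
  (forall V s W t, prod_family B V s W t = prod_family B' V s W t) -> B = B'.
Proof.
move=> e; have {}e : prod_family B = prod_family B'.
  by do 4 (apply: functional_extensionality_dep => ?).
have eth : th B = th B'.
  apply: functional_extensionality_dep => t; apply: monNatAut_eq => Z.
  by rewrite -!prod_family_th e.
have ethb : thb B = thb B'.
  apply: functional_extensionality_dep => t; apply: monNatAut_eq => Z.
  by rewrite -!prod_family_thb e.
have etw : tw B = tw B'.
  apply: functional_extensionality_dep => s; apply: functional_extensionality_dep => t.
  by apply: iso_eq_tensor; rewrite -!prod_family_tw e.
case: B B' {e} eth ethb etw => [? ? ? p1 p2 p3 p4 p5 p6 p7 p8 p9 p10]
  [? ? ? q1 q2 q3 q4 q5 q6 q7 q8 q9 q10] /= e1 e2 e3; subst.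
rewrite (Prop_irrelevance p1 q1) (Prop_irrelevance p2 q2) (Prop_irrelevance p3 q3).
rewrite (Prop_irrelevance p4 q4) (Prop_irrelevance p5 q5) (Prop_irrelevance p6 q6).
rewrite (Prop_irrelevance p7 q7) (Prop_irrelevance p8 q8) (Prop_irrelevance p9 q9).
by rewrite (Prop_irrelevance p10 q10).
Qed.

End Uniqueness.

Theorem theorem5p4 (k : fieldType) (G : groupType) (C : tensorCat k)
  (mulGC : forall s t : G, (s * t = t * s)%g)
  (c : braiding C) (A : centralOuterAction G C) :
  exists f : crossedBraiding A c -> actionBraiding mulGC c A, bijective f.
Proof.
pose f (b : crossedBraiding A c) : actionBraiding mulGC c A :=
  action_of mulGC (family_ofK (sval b)) (family_ofVK (sval b))
    (family_of_natural mulGC (sval b)) (family_of_hexagon1 mulGC (sval b))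
    (family_of_hexagon2 mulGC (sval b)) (svalP b).
have fE b V s W t : prod_family (f b) V s W t = family_of (sval b) V s W t.
  exact: prod_family_action_of.
pose g0 (B : actionBraiding mulGC c A) := braiding_of mulGC (prod_familyK B) (prod_familyVK B)
  (prod_natural B) (prod_hexagon1 B) (prod_hexagon2 B).
have g0E (B : actionBraiding mulGC c A) V s W t :
    family_of (g0 B) V s W t = prod_family B V s W t.
  exact: family_of_braiding_of.
have g0c B : extends_braiding c (g0 B).
  by move=> V W; rewrite -/(family_of _ _ _ _ _) g0E prod_unit.
pose g B : crossedBraiding A c := exist _ (g0 B) (g0c B).
have sval_inj (x y : crossedBraiding A c) : sval x = sval y -> x = y.
  case: x y => [x px] [y py] /= e; subst y; by rewrite (Prop_irrelevance px py).
(* Both composites preserve the family on homogeneous objects, and the family determines either kind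
   of braiding. *)
exists f; exists g => [b|B].
  by apply/sval_inj/(family_of_inj mulGC) => V s W t; rewrite g0E fE.
by apply: prod_family_inj => V s W t; rewrite fE g0E.
Qed.
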